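(* Let $\omega\in C^1\Lambda^k(\mathcal{P})$. There is a constant $C$, depending on $\omega$ but not on $h$ or on the simplices, such that for every $h$, every $n$-simplex $\sigma$ of $K_h$ and every $k$-dimensional face $\tau$ of $\sigma$, $$\big|\langle \star_h R_h\omega,\ast\tau\rangle-\langle R_h\star\omega,\ast\tau\rangle\big|\le C\,\frac{h^{n+1}}{\gamma_\tau^{\,k}}.$$
   Context: Let $\mathcal{P}\subset\mathbb{R}^n$ be an $n$-dimensional polytope and $\{K_h\}_{h>0}$ a family of simplicial complexes triangulating $\mathcal{P}$ (the union of the $n$-simplices is $\mathcal{P}$), where $h$ is the length of the longest edge of $K_h$. Each $K_h$ is well-centered: the circumcenter $c(s)$ of every simplex $s$ of every dimension lies in the relative interior of $s$. $\gamma_s$ is the radius of the largest $\dim(s)$-dimensional ball contained in $s$. All simplices are oriented, the $n$-simplices with the standard orientation of $\mathbb{R}^n$. $|s|$ is the $k$-volume of a $k$-simplex $s$ (vertices have volume $1$). For a $k$-simplex $\tau$, the circumcentric dual $\ast\tau$ is the $(n-k)$-dimensional cell formed by the union of the simplices $[c(\tau),c(\tau_{k+1}),\dots,c(\tau_n)]$ over all chains $\tau\prec\tau_{k+1}\prec\dots\prec\tau_n$ of simplices of $K_h$ with $\dim\tau_j=j$. It lies in the affine plane through $c(\tau)$ orthogonal to $\tau$, and is oriented so that an oriented basis of $\tau$ followed by an oriented basis of $\ast\tau$ is positively oriented in $\mathbb{R}^n$. $|\ast\tau|$ is its $(n-k)$-volume, with $|\ast\sigma|=1$ for $n$-simplices.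 $C^1\Lambda^k(\mathcal{P})$ is the set of restrictions to $\mathcal{P}$ of $C^1$ differential $k$-forms defined on an open set containing $\mathcal{P}$. $\star$ is the Euclidean Hodge star. The de Rham map is $\langle R_h\omega,s\rangle=\int_s\omega$ for $s$ an oriented $k$-simplex or dual $k$-cell. The discrete Hodge star of a $k$-cochain $\alpha$ (a real function on oriented $k$-simplices, changing sign with orientation) is the cochain on dual cells given by $\langle\star_h\alpha,\ast\tau\rangle=\frac{|\ast\tau|}{|\tau|}\langle\alpha,\tau\rangle$. *)

(* Defs.v *)
From mathcomp Require Import all_boot all_order all_algebra.
From mathcomp Require Import all_classical all_reals all_analysis.
Set Implicit Arguments. Unset Strict Implicit. Unset Printing Implicit Defensive.
Import Order.TTheory GRing.Theory Num.Theory.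
Import numFieldNormedType.Exports.
Local Open Scope classical_set_scope.
Local Open Scope ring_scope.

Section DEC.
Variables (R : realType) (n : nat).
Local Notation point := 'rV[R]_n.

Definition edot (u v : point) : R := \sum_(i < n) u 0 i * v 0 i.
Definition enorm (u : point) : R := Num.sqrt (edot u u).

(** A (geometric) simplex is given by the list of its vertices
    [x0; x1; ...; xk]; the order of the list is its orientation. *)
Definition elist (xs : seq point) : seq point :=
  [seq x - head 0 xs | x <- behead xs].

Definition sdet (vs : seq point) : R :=
  \det (\matrix_(i < n, j < n) (nth 0 vs i) 0 j).

Definition affine_indep (xs : seq point) : Prop :=
  \rank (\matrix_(i < size (elist xs)) nth 0 (elist xs) i) = size (elist xs).

Definition conv (xs : seq point) : set point :=
  [set y | exists l : 'I_(size xs) -> R, (forall i, 0 <= l i) /\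
     \sum_i l i = 1 /\ y = \sum_i l i *: nth 0 xs i].
Definition aff (xs : seq point) : set point :=
  [set y | exists l : 'I_(size xs) -> R,
     \sum_i l i = 1 /\ y = \sum_i l i *: nth 0 xs i].
Definition relint (xs : seq point) : set point :=
  [set y | exists l : 'I_(size xs) -> R, (forall i, 0 < l i) /\
     \sum_i l i = 1 /\ y = \sum_i l i *: nth 0 xs i].

Definition is_circumcenter (xs : seq point) (c : point) : Prop :=
  aff xs c /\ forall x, x \in xs -> enorm (x - c) = enorm (head 0 xs - c).
Definition circumcenter (xs : seq point) : point :=
  xget 0 (is_circumcenter xs).

(** k-volume of a k-simplex (Gram determinant); a vertex has volume 1 *)
Definition vol (xs : seq point) : R :=
  let E := elist xs in let m := size E in
  Num.sqrt (\det (\matrix_(i < m, j < m) edot (nth 0 E i) (nth 0 E j)))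
  / (m`!)%:R.

Definition inrad (xs : seq point) : R :=
  sup [set r : R | 0 <= r /\ exists c, aff xs c /\
        forall y, aff xs y -> enorm (y - c) <= r -> conv xs y].

(** A simplicial complex triangulating an n-dimensional region is given by
    the list of its n-simplices; all simplices are the faces of those. *)
Definition mesh (K : seq (seq point)) : R :=
  \big[Num.max/0]_(s <- K) \big[Num.max/0]_(x <- s) \big[Num.max/0]_(y <- s)
     enorm (x - y).

Definition is_nsimplex (s : seq point) : Prop :=
  size s = n.+1 /\ affine_indep s.

Definition union_hulls (K : seq (seq point)) : set point :=
  [set x | exists2 s, s \in K & conv s x].

Definition is_polytope (P : set point) : Prop :=
  exists L : seq (seq point), (forall s, s \in L -> is_nsimplex s) /\
    P = union_hulls L.

Definition triangulates (K : seq (seq point)) (P : set point) : Prop :=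
  [/\ (forall s, s \in K -> is_nsimplex s /\ 0 < sdet (elist s)),
      uniq K /\ (forall s1 s2, s1 \in K -> s2 \in K -> perm_eq s1 s2 -> s1 = s2),
      (forall s1 s2, s1 \in K -> s2 \in K ->
          conv s1 `&` conv s2 = conv [seq x <- s1 | x \in s2]) &
      P = union_hulls K].

Definition well_centered (K : seq (seq point)) : Prop :=
  forall s, s \in K -> forall t, subseq t s -> t != [::] ->
    relint t (circumcenter t).

(** Differential forms: omega = \sum_I omega_I dx^I, coefficients indexed by
    subsets I of 'I_n (only those of the right cardinality matter). *)
Definition kform := {set 'I_n} -> point -> R.

Definition formval (w : kform) (x : point) (vs : seq point) : R :=
  \sum_(I : {set 'I_n} | #|I| == size vs)
     w I x * \det (\matrix_(a < size vs, b < size vs)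
                     nth 0 [seq (nth 0 vs b) 0 i | i <- enum I] a).

(** Euclidean Hodge star: *(dx^I) = eps(I,I^c) dx^(I^c), eps the sign of the
    permutation listing I then I^c (each increasingly). *)
Definition inv_count (I : {set 'I_n}) : nat :=
  \sum_(i in I) #|[set j | (j \notin I) && (j < i)%N]|.
Definition hodge (w : kform) : kform :=
  fun J x => (-1) ^+ (inv_count (~: J)) * w (~: J) x.

(** integral over the standard simplex {t >= 0, sum t <= s} in R^k as an
    iterated Lebesgue integral *)
Fixpoint simplex_int (k : nat) (f : seq R -> R) (s : R) : R :=
  match k with
  | 0 => f [::]
  | k'.+1 => Rintegral (@lebesgue_measure R) `[0, s]
               (fun t => simplex_int k' (fun ts => f (t :: ts)) (s - t))
  end.

Definition sint (w : kform) (xs : seq point) : R :=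
  let E := elist xs in
  simplex_int (size E)
    (fun t => formval w (head 0 xs + \sum_(p <- zip t E) p.1 *: p.2) E) 1.

(** Circumcentric dual cell of tau (a k-simplex, face of the complex K):
    union over chains tau < tau_{k+1} < ... < tau_n of simplices of K of
    [c(tau), c(tau_{k+1}), ..., c(tau_n)].  A chain = an n-simplex s of K
    containing tau plus an ordering p of the vertices of s not in tau. *)
Definition chains (K : seq (seq point)) (tau : seq point)
  : seq (seq point) :=
  flatten [seq permutations [seq x <- s | x \notin tau]
          | s <- K & all (fun x => x \in s) tau].
Definition piece (tau p : seq point) : seq point :=
  [seq circumcenter (tau ++ take j p) | j <- iota 0 (size p).+1].

Definition dual_vol (K : seq (seq point)) (tau : seq point) : R :=
  \sum_(p <- chains K tau) vol (piece tau p).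

(** <R_h alpha, *tau>, pieces oriented so that an oriented basis of tau
    followed by one of *tau is positive in R^n *)
Definition dual_int (a : kform) (K : seq (seq point)) (tau : seq point) : R :=
  \sum_(p <- chains K tau)
    Num.sg (sdet (elist tau ++ elist (piece tau p))) * sint a (piece tau p).

Definition disc_hodge_int (w : kform) (K : seq (seq point)) (tau : seq point)
  : R := dual_vol K tau / vol tau * sint w tau.

Definition C1_form_on (P : set point) (k : nat) (w : kform) : Prop :=
  exists U : set point, open U /\ P `<=` U /\
    forall I : {set 'I_n}, #|I| = k ->
      (forall x, U x -> {for x, continuous (w I)}) /\
      forall j : 'I_n,
        (forall x, U x -> derivable (w I) x (delta_mx 0 j)) /\
        (forall x, U x -> {for x, continuous (fun y => derive (w I) y (delta_mx 0 j))}).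

End DEC.

(* Main.v *)
Require Import Defs.
From mathcomp Require Import all_boot all_order all_algebra.
From mathcomp Require Import all_classical all_reals all_analysis.
From mathcomp Require Import ring lra zify.
Set Implicit Arguments. Unset Strict Implicit. Unset Printing Implicit Defensive.
Import Order.TTheory GRing.Theory Num.Theory.
Import numFieldNormedType.Exports.
Local Open Scope classical_set_scope.
Local Open Scope ring_scope.

(** Freeze omega at the circumcenter c of tau.  The pieces of the dual cell are
    orthogonal to tau, so for the frozen form the two terms agree piece by piece
    (an identity between complementary minors); as omega is Lipschitz on the
    compact P, freezing costs O(h |piece|) for each piece.
    The number of n-simplices around tau is not bounded, so |*tau| is bounded
    through volumes instead: tau and a piece lie in a common n-simplex s of K
    by well-centeredness, whence |tau| |piece| <= C |s|, and the simplices
    around tau are disjoint and lie in a box of side 2h, whence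
    |tau| |*tau| <= C h^n.  Finally gamma^k <= C |tau|.
    The n-dimensional packing bound is obtained without n-dimensional Lebesgue
    measure, by counting points of the lattice Z^n / N as N goes to infinity. *)

(** No shape regularity is assumed: the simplices around tau may be arbitrarily thin, so neither
    their number nor a single ratio |piece| / |tau| is controlled by h alone. What can be summed is
    the determinant of each n-simplex, because the interiors are disjoint. Hence a piece is measured
    only through the product |tau| |piece|, which by orthogonality is, up to factorials, the
    determinant of a matrix whose rows are differences of points of s. Division by |tau| is
    postponed to the very end and is the origin of gamma^k in the denominator; h^(n+1) is h^n from
    the packing times h from freezing. For the same reason the freezing errors must be relative to
    |tau| and |piece|, so minors are bounded by Gram determinants and not by products of edge
    lengths. These comparisons (minors, inscribed ball, positivity) all rest on one monotonicity of
    determinants, [det_mono]. P need not be convex, so the Lipschitz constant of omega on P comes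
    from a covering of P x P and not from segments. *)

(** * Iterated integrals *)

(* No measurability is assumed: the integral is a difference of suprema over
   simple functions, which are monotone for arbitrary integrands.  This spares
   the measurability of the inner integrals of simplex_int. *)
Lemma le_integral_nonmeas d (T : measurableType d) (R : realType)
  (mu : {measure set T -> \bar R}) (D : set T) (f g : T -> \bar R) :
  (forall x, D x -> (f x <= g x)%E) ->
  (\int[mu]_(x in D) f x <= \int[mu]_(x in D) g x)%E.
Proof.
move=> fg; have fgD x : ((f \_ D) x <= (g \_ D) x)%E.
  by rewrite !patchE; case: ifPn => // /[1!inE] /fg.
rewrite /integral; apply: leeB; apply: ereal_sup_le => _ [h /= hle <-];
  exists h => //= x; apply: (le_trans (hle x)).
- by apply: (@funepos_le _ _ setT) => [? _|]; rewrite ?inE.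
- by apply: (@funeneg_le _ _ setT) => [? _|]; rewrite ?inE.
Qed.

Lemma continuous_subrX (R : realType) (k : nat) (s : R) :
  continuous (fun t : R => (s - t) ^+ k).
Proof.
move=> x; have -> : (fun t => (s - t) ^+ k) = (cst s - id : R -> R) ^+ k.
  by apply/funext => t; rewrite exprfctE.
apply/differentiable_continuous/derivable1_diffP; apply: ex_derive.
Qed.

Lemma integral_subrX (R : realType) (k : nat) (s : R) : 0 <= s ->
  (\int[@lebesgue_measure R]_(t in `[0%R, s]) ((s - t) ^+ k)%R%:E
    = (s ^+ k.+1 / k.+1%:R)%:E)%E.
Proof.
rewrite le_eqVlt => /predU1P[<-|s0].
  by rewrite set_itv1 integral_set1 expr0n/= mul0r.
have dF x : is_derive x (1:R) (fun t => - ((s - t) ^+ k.+1 / k.+1%:R)) ((s - x) ^+ k).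
  have -> : (fun t => - ((s - t) ^+ k.+1 / k.+1%:R)) =
            (- (k.+1%:R)^-1) \*: ((cst s - id : R -> R) ^+ k.+1).
    by apply/funext => t; rewrite exprfctE /= /GRing.scale/= mulNr mulrC.
  have d1 : is_derive x (1:R) (cst s - id : R -> R) (0 - 1) by exact: is_deriveB.
  apply: (@is_derive_eq _ _ _ _ _ _ _ _ (is_deriveZ _ (is_deriveX _ d1))).
  rewrite /GRing.scale/= fctE.
  have : k.+1%:R != 0 :> R by rewrite pnatr_eq0.
  by move=> ku; field.
have dc := @continuous_subrX R k s.
have dFc : continuous (fun t => - ((s - t) ^+ k.+1 / k.+1%:R)).
  by move=> x; apply/differentiable_continuous/derivable1_diffP; have [] := dF x.
rewrite (@continuous_FTC2 _ _ (fun t => - ((s - t) ^+ k.+1 / k.+1%:R))) //.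
- by rewrite -EFinB subrr expr0n/= mul0r subr0 oppr0 sub0r opprK.
- exact: continuous_subspaceT.
- split; first by move=> x _; have [] := dF x.
  + by apply: cvg_at_right_filter; exact: dFc.
  + by apply: cvg_at_left_filter; exact: dFc.
- by move=> x _; rewrite derive1E; apply: (@derive_val _ _ _ _ _ _ _ (dF x)).
Qed.

(** The factor s^k / k! is the volume of the simplex of size s. The size is kept general because the
    inner integral in the induction runs over a simplex of size s - t. *)
Lemma simplex_int_bounds (R : realType) (k : nat) (a b : R) :
  forall (f : seq R -> R) (s : R), 0 <= s ->
  (forall ts, size ts = k -> all (fun t => 0 <= t) ts -> \sum_(t <- ts) t <= s ->
     a <= f ts <= b) ->
  a * (s ^+ k / k`!%:R) <= simplex_int k f s <= b * (s ^+ k / k`!%:R).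
Proof.
elim: k => [|k IH] f s s0 fab /=.
  by rewrite expr0 fact0 divr1 !mulr1; apply: fab; rewrite ?big_nil.
set F := fun t : R => simplex_int _ _ _.
have Fab t : `[0, s]%classic t ->
    a / k`!%:R * (s - t) ^+ k <= F t <= b / k`!%:R * (s - t) ^+ k.
  rewrite /= in_itv/= => /andP[t0 ts].
  rewrite !(mulrAC _ _ ((s - t) ^+ k)) -!(mulrA _ (_ ^+ k)).
  apply: IH; rewrite ?subr_ge0// => us su upos uss.
  by apply: fab; rewrite /= ?su ?t0//= big_cons -lerBrDl.
have E c : ((\int[@lebesgue_measure R]_(t in `[0%R, s])
    ((c / k`!%:R * (s - t) ^+ k)%R)%:E) = (c * (s ^+ k.+1 / (k.+1)`!%:R))%:E)%E.
  under eq_integral do rewrite EFinM.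
  rewrite integralZl//; last first.
    apply: (@continuous_compact_integrable _ (fun t => (s - t) ^+ k)).
      exact: segment_compact.
    by apply: continuous_subspaceT; exact: continuous_subrX.
  rewrite integral_subrX// -EFinM; congr EFin.
  have h1 : k.+1%:R != 0 :> R by rewrite pnatr_eq0.
  have h2 : k`!%:R != 0 :> R by rewrite pnatr_eq0 -lt0n fact_gt0.
  rewrite factS natrM; move: (k.+1%:R) (k`!%:R) h1 h2 (s ^+ k.+1) => u w hu hw v.
  by field; rewrite hu hw.
have lo : ((a * (s ^+ k.+1 / (k.+1)`!%:R))%:E <=
    \int[@lebesgue_measure R]_(t in `[0%R, s]) (F t)%:E)%E.
  by rewrite -E; apply: le_integral_nonmeas => t /Fab /andP[]; rewrite lee_fin.
have hi : (\int[@lebesgue_measure R]_(t in `[0%R, s]) (F t)%:E <=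
   (b * (s ^+ k.+1 / (k.+1)`!%:R))%:E)%E.
  by rewrite -E; apply: le_integral_nonmeas => t /Fab /andP[]; rewrite lee_fin.
(* [fine] is 0 at infinity, so finiteness of the integral must be known; it is read off from [lo]
   and [hi], no integrability of [F] being available. *)
rewrite /Rintegral -!lee_fin fineK ?lo ?hi//.
rewrite fin_numE; apply/andP; split; apply/eqP => eq.
  by rewrite eq in lo.
by rewrite eq in hi.
Qed.

(** * Gram determinants *)

Section DetMono.
Variable R : realFieldType.

Definition qform n (A : 'M[R]_n) (u : 'rV[R]_n) : R := (u *m A *m u^T) 0 0.

Lemma det_schur n (a : 'M[R]_1) (r : 'rV[R]_n) (c : 'cV[R]_n) (D : 'M[R]_n) :
  D \in unitmx ->
  \det (block_mx a r c D) = (a - r *m invmx D *m c) 0 0 * \det D.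
Proof.
move=> uD.
have := det_ublock (a - r *m invmx D *m c) r D.
have -> : block_mx (a - r *m invmx D *m c) r 0 D =
  block_mx a r c D *m block_mx 1%:M 0 (- (invmx D *m c)) 1%:M.
  rewrite mulmx_block !mulmx1 !mulmx0 !add0r !mulmxN mulmxA.
  by rewrite [D *m (_ *m _)]mulmxA mulmxV// mul1mx subrr.
by rewrite det_mulmx det_lblock !det1 !mulr1 det_mx11.
Qed.

(** Completing the square. For D positive definite the minimum over u is the Schur complement,
    attained at u = - r D^-1. *)
Lemma qform_block n (a : 'M[R]_1) (r u : 'rV[R]_n) (D : 'M[R]_n) :
  D \in unitmx -> D^T = D ->
  qform (block_mx a r r^T D) (row_mx 1%:M u) =
  (a - r *m invmx D *m r^T) 0 0 + qform D (u + r *m invmx D).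
Proof.
move=> uD sD; rewrite /qform mul_row_block tr_row_mx mul_row_col trmx1.
rewrite !mul1mx mulmx1 linearD/= trmx_mul trmx_inv sD mulmxDl.
rewrite [in RHS]mulmxDl -[r *m invmx D *m D]mulmxA mulVmx// mulmx1.
rewrite !mulmxDr !mulmxDl -[u *m D *m (_ *m _)]mulmxA [D *m (_ *m _)]mulmxA.
rewrite mulmxV// mul1mx !mulmxA !mxE; ring.
Qed.

(** The determinant is the Schur complement times a smaller determinant, and the Schur complement is
    the minimum of the form over vectors with first coordinate 1, hence monotone in the form. *)
Lemma det_mono n (A B : 'M[R]_n) : A^T = A -> B^T = B ->
  (forall u, u != 0 -> 0 < qform B u <= qform A u) ->
  0 < \det B <= \det A.
Proof.
elim: n A B => [|n IH] A B sA sB AB; first by rewrite !det_mx00 lexx ltr01.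
move: A B sA sB AB; rewrite -[n.+1]/(1 + n)%N => A B.
rewrite -[A]submxK -[B]submxK.
move: (ulsubmx A) (ursubmx A) (dlsubmx A) (drsubmx A) => a r c D.
move: (ulsubmx B) (ursubmx B) (dlsubmx B) (drsubmx B) => a' r' c' D'.
rewrite !tr_block_mx => /eq_block_mx[_ _ <- sD] /eq_block_mx[_ _ <- sD'] AB.
have restr (X : 'M[R]_1) (Y : 'rV[R]_n) Z (W : 'M[R]_n) u :
    qform (block_mx X Y Z W) (row_mx 0 u) = qform W u.
  rewrite /qform mul_row_block tr_row_mx mul_row_col !mul0mx !add0r trmx0.
  by rewrite mulmx0 add0r.
have AB' u : u != 0 -> 0 < qform D' u <= qform D u.
  move=> u0; rewrite -(restr a' r' r'^T D') -(restr a r r^T D); apply: AB.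
  apply: contra u0 => /eqP /(congr1 rsubmx); rewrite row_mxKr linear0.
  by move=> ->.
have /andP[D'0 D'D] := IH _ _ sD sD' AB'.
have D0 := lt_le_trans D'0 D'D.
have uD : D \in unitmx by rewrite unitmxE unitfE gt_eqF.
have uD' : D' \in unitmx by rewrite unitmxE unitfE gt_eqF.
have nz u : row_mx (1%:M : 'M[R]_1) u != 0 :> 'rV_(1 + n).
  apply/eqP => /(congr1 (fun M => lsubmx M 0 0)); rewrite row_mxKl !mxE => /eqP.
  by rewrite oner_eq0.
rewrite !det_schur//.
have q0 (X : 'M[R]_n) : qform X 0 = 0 by rewrite /qform !mul0mx mxE.
have qD'0 u : 0 <= qform D' u.
  by have [->|/AB' /andP[/ltW]//] := eqVneq u 0; rewrite q0.
have s'0 : 0 < (a' - r' *m invmx D' *m r'^T) 0 0.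
  have /AB/andP[+ _] := nz (- (r' *m invmx D')).
  by rewrite !qform_block// addNr q0 addr0.
(* Evaluate at the minimizer of A: there A equals its Schur complement, while B is its own plus a
   nonnegative term. *)
have ss : (a' - r' *m invmx D' *m r'^T) 0 0 <= (a - r *m invmx D *m r^T) 0 0.
  have /AB/andP[_] := nz (- (r *m invmx D)).
  rewrite !qform_block// addNr q0 addr0; apply: le_trans.
  by rewrite lerDl.
by rewrite mulr_gt0//= ler_pM// ltW.
Qed.

Definition dotmx n (u v : 'rV[R]_n) : R := (u *m v^T) 0 0.

Lemma dotmxE n (u v : 'rV[R]_n) : dotmx u v = \sum_i u 0 i * v 0 i.
Proof. by rewrite /dotmx mxE; apply: eq_bigr => i _; rewrite mxE. Qed.

Lemma dotmx_ge0 n (u : 'rV[R]_n) : 0 <= dotmx u u.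
Proof. by rewrite dotmxE sumr_ge0// => i _; rewrite -expr2 sqr_ge0. Qed.

Lemma dotmx_eq0 n (u : 'rV[R]_n) : dotmx u u = 0 -> u = 0.
Proof.
rewrite dotmxE => /eqP; rewrite psumr_eq0 => [/allP u0|i _]; last first.
  by rewrite -expr2 sqr_ge0.
apply/rowP => i; rewrite mxE; apply/eqP.
by have := u0 i (mem_index_enum _); rewrite mulf_eq0 orbb.
Qed.

Lemma qform_gram m n (E : 'M[R]_(m, n)) (u : 'rV[R]_m) :
  qform (E *m E^T) u = dotmx (u *m E) (u *m E).
Proof. by rewrite /qform /dotmx trmx_mul !mulmxA. Qed.

Lemma gram_unit_inj m n (E : 'M[R]_(m, n)) (u : 'rV[R]_m) :
  E *m E^T \in unitmx -> u *m E = 0 -> u = 0.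
Proof.
move=> uE E0; have : u *m (E *m E^T) = 0 by rewrite mulmxA E0 mul0mx.
by move/(congr1 (mulmx^~ (invmx (E *m E^T)))); rewrite mulmxK// mul0mx.
Qed.

Lemma gram_det_gt0 m n (E : 'M[R]_(m, n)) :
  (forall u : 'rV[R]_m, u *m E = 0 -> u = 0) -> 0 < \det (E *m E^T).
Proof.
move=> uE; have sG : (E *m E^T)^T = E *m E^T by rewrite trmx_mul trmxK.
(* [det_mono] with A = B, for its positivity half. *)
suff qq u : u != 0 -> 0 < qform (E *m E^T) u <= qform (E *m E^T) u.
  by have /andP[] := det_mono sG sG qq.
move=> u0; rewrite lexx andbT qform_gram.
rewrite lt_neqAle dotmx_ge0 andbT eq_sym; apply: contra u0 => /eqP.
by move=> /dotmx_eq0 /uE ->.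
Qed.

Lemma gram_det_ge0 m n (E : 'M[R]_(m, n)) : 0 <= \det (E *m E^T).
Proof.
have [uE|] := boolP (E *m E^T \in unitmx).
  by rewrite ltW// gram_det_gt0// => u; exact: gram_unit_inj.
by rewrite unitmxE unitfE negbK => /eqP ->.
Qed.

Lemma sum_inj_le (I J : finType) (g : I -> J) (f : J -> R) : injective g ->
  (forall j, 0 <= f j) -> \sum_i f (g i) <= \sum_j f j.
Proof.
move=> gI f0; rewrite [leRHS](bigID (mem (g @: finset.setTfor I)))/=.
rewrite big_imset/=; last by move=> x y _ _ /gI.
have -> : \sum_(i in finset.setTfor I) f (g i) = \sum_i f (g i).
  by apply: eq_bigl => i; rewrite finset.in_setT.
by rewrite lerDl sumr_ge0.
Qed.

(* Both sides are Gram determinants, and dropping columns decreases the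
   quadratic form. *)
Lemma minor_le_gram k n (E : 'M[R]_(k, n)) (g : 'I_k -> 'I_n) : injective g ->
  \det (colsub g E) ^+ 2 <= \det (E *m E^T).
Proof.
move=> gI; have -> : \det (colsub g E) ^+ 2 = \det (colsub g E *m (colsub g E)^T).
  by rewrite det_mulmx det_tr.
have [uE|] := boolP (colsub g E *m (colsub g E)^T \in unitmx); last first.
  rewrite unitmxE unitfE negbK => /eqP ->; exact: gram_det_ge0.
have sG m (F : 'M[R]_(k, m)) : (F *m F^T)^T = F *m F^T by rewrite trmx_mul trmxK.
suff qq u : u != 0 -> 0 < qform (colsub g E *m (colsub g E)^T) u <= qform (E *m E^T) u.
  by have /andP[] := det_mono (sG _ E) (sG _ (colsub g E)) qq.
move=> u0; rewrite !qform_gram; apply/andP; split.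
  rewrite lt_neqAle dotmx_ge0 andbT eq_sym; apply: contra u0 => /eqP.
  by move=> /dotmx_eq0 /(gram_unit_inj uE) ->.
rewrite mulmx_colsub !dotmxE.
under eq_bigr => i _ do rewrite [colsub _ _ _ _]mxE.
apply: (@sum_inj_le _ _ g (fun i => (u *m E) 0 i * (u *m E) 0 i)) => // i.
by rewrite -expr2 sqr_ge0.
Qed.

End DetMono.

(** * Complementary minors *)

Section HodgeMx.
Variable R : realFieldType.

Section Perm.
Variables (k m : nat) (g : 'I_k -> 'I_(k + m)) (g' : 'I_m -> 'I_(k + m)).
Hypothesis (gI : injective g) (gI' : injective g').
Hypothesis gg' : forall i j, g i != g' j.

(** The permutation matrix listing I, the image of g, and then its complement; its determinant is
    the sign occurring in the Hodge star. *)
Definition selmx : 'M[R]_(k + m) := col_mx (rowsub g 1%:M) (rowsub g' 1%:M).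

Lemma rowsub_delta p q (h : 'I_p -> 'I_(k + m)) (h' : 'I_q -> 'I_(k + m)) :
  (rowsub h 1%:M : 'M[R]_(_, _)) *m (rowsub h' 1%:M)^T = \matrix_(i, j) (h i == h' j)%:R.
Proof.
apply/matrixP => i j; rewrite !mxE (bigD1 (h i))//= big1 ?addr0 => [|l li].
  by rewrite !mxE eqxx mul1r eq_sym.
by rewrite !mxE eq_sym (negbTE li) mul0r.
Qed.

Lemma selmx_orth : selmx *m selmx^T = 1%:M.
Proof.
rewrite /selmx tr_col_mx mul_col_row !rowsub_delta -[RHS]submxK.
rewrite scalar_mx_block block_mxKul block_mxKur block_mxKdl block_mxKdr.
congr block_mx; apply/matrixP => i j; rewrite !mxE ?(inj_eq gI) ?(inj_eq gI')//.
  by rewrite (negbTE (gg' _ _)).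
by rewrite eq_sym (negbTE (gg' _ _)).
Qed.

Lemma det_selmx_sqr : \det selmx * \det selmx = 1.
Proof. by rewrite -{2}det_tr -det_mulmx selmx_orth det1. Qed.

Lemma mul_rowsub1T p q (h : 'I_p -> 'I_(k + m)) (F : 'M[R]_(q, k + m)) :
  F *m (rowsub h 1%:M)^T = colsub h F.
Proof.
apply/matrixP => i j; rewrite !mxE (bigD1 (h j))//= big1 ?addr0 => [|l li].
  by rewrite !mxE eqxx mulr1.
by rewrite !mxE eq_sym (negbTE li) mulr0.
Qed.

(** The matrix N, made of the g-rows of the identity above F, is multiplied by the transposes of
    [selmx] and of (E; F). Both products are block triangular, the second one because F E^T = 0, and
    \det N is eliminated between the two. *)
Lemma complementary_minor (E : 'M[R]_(k, k + m)) (F : 'M[R]_(m, k + m)) :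
  E *m F^T = 0 ->
  \det (col_mx E F) * (\det selmx * \det (colsub g' F)) =
  \det (colsub g E) * \det (F *m F^T).
Proof.
move=> EF; set N := col_mx (rowsub g 1%:M) F.
have NP : \det N * \det selmx = \det (colsub g' F).
  rewrite -[\det selmx]det_tr -det_mulmx /N /selmx tr_col_mx mul_col_row.
  rewrite !rowsub_delta !mul_rowsub1T.
  have -> : \matrix_(i, j) (g i == g j)%:R = 1%:M :> 'M[R]_k.
    by apply/matrixP => i j; rewrite !mxE (inj_eq gI).
  have -> : \matrix_(i, j) (g i == g' j)%:R = 0 :> 'M[R]_(k, m).
    by apply/matrixP => i j; rewrite !mxE (negbTE (gg' _ _)).
  by rewrite det_lblock det1 mul1r.
have DN : \det N * \det (col_mx E F) = \det (colsub g E) * \det (F *m F^T).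
  rewrite -[\det (col_mx E F)]det_tr -det_mulmx /N tr_col_mx mul_col_row.
  have -> : F *m E^T = 0 by rewrite -[F]trmxK -trmx_mul EF trmx0.
  rewrite det_ublock; congr (_ * _); rewrite -det_tr trmx_mul trmxK.
  by rewrite mul_rowsub1T.
rewrite -NP -DN.
transitivity (\det N * \det (col_mx E F) * (\det selmx * \det selmx)); first by ring.
by rewrite det_selmx_sqr mulr1.
Qed.

Lemma det_col_mx_orth (E : 'M[R]_(k, k + m)) (F : 'M[R]_(m, k + m)) :
  E *m F^T = 0 ->
  \det (col_mx E F) ^+ 2 = \det (E *m E^T) * \det (F *m F^T).
Proof.
move=> EF; rewrite expr2 -{2}det_tr -det_mulmx tr_col_mx mul_col_row EF.
have -> : F *m E^T = 0 by rewrite -[F]trmxK -trmx_mul EF trmx0.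
by rewrite det_ublock.
Qed.

Hypothesis gmono : forall i j : 'I_k, (i < j)%N -> (g i < g j)%N.
Hypothesis gmono' : forall i j : 'I_m, (i < j)%N -> (g' i < g' j)%N.

(** Permuting the columns of the Vandermonde matrix with nodes 0, 1, ..., k+m-1, of positive
    determinant, multiplies it by [\det selmx]. The sign of the permuted product counts inversions,
    and only pairs with one index in each block can be inverted, g and g' being increasing. *)
Lemma det_selmx :
  \det selmx = (-1) ^+ (\sum_i \sum_j (g' j < g i)%N).
Proof.
pose s (i : 'I_(k + m)) := match fintype.split i with inl a => g a | inr b => g' b end.
have sl a : s (lshift m a) = g a.
  by rewrite /s -[lshift m a]/(unsplit (inl a)) unsplitK.
have sr b : s (rshift k b) = g' b.
  by rewrite /s -[rshift k b]/(unsplit (inr b)) unsplitK.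
pose a : 'rV[R]_(k + m) := \row_i i%:R.
pose V := Vandermonde (k + m) a.
have VP : \det V * \det selmx = \prod_(i < k + m) \prod_(j < k + m | (i < j)%N)
    ((s j)%:R - (s i)%:R).
  rewrite -[\det selmx]det_tr -det_mulmx.
  have -> : V *m selmx^T = Vandermonde (k + m) (\row_i (s i)%:R).
    rewrite /selmx tr_col_mx mul_mx_row !mul_rowsub1T.
    apply/matrixP => i j; rewrite -[j]splitK /unsplit; case: (fintype.split j) => l.
      by rewrite row_mxEl !mxE sl.
    by rewrite row_mxEr !mxE sr.
  by rewrite det_Vandermonde; do 2!under eq_bigr do [idtac]; under eq_bigr do under eq_bigr do rewrite !mxE.
have V0 : 0 < \det V.
  rewrite det_Vandermonde; do 2!apply: prodr_gt0 => ? ?.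
  by rewrite !mxE subr_gt0 ltr_nat.
have sg1 : \det selmx = Num.sg (\det selmx).
  have /eqP := det_selmx_sqr; rewrite -expr2 sqrf_eq1 => /orP[]/eqP ->.
    by rewrite sgr1.
  by rewrite sgrN1.
rewrite sg1; have -> : Num.sg (\det selmx) = Num.sg (\det V * \det selmx).
  by rewrite sgrM (gtr0_sg V0) mul1r.
rewrite VP.
have sgp (I : finType) (P : pred I) (f : I -> R) :
    Num.sg (\prod_(i | P i) f i) = \prod_(i | P i) Num.sg (f i).
  by apply: (big_morph _ (@sgrM _)); rewrite sgr1.
have sI : injective s.
  move=> i j; rewrite -[i]splitK -[j]splitK /unsplit.
  case: (fintype.split i) => x; case: (fintype.split j) => y; rewrite ?sl ?sr.
  - by move=> /gI ->.
  - by move=> /eqP; rewrite (negbTE (gg' _ _)).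
  - by move=> /eqP; rewrite eq_sym (negbTE (gg' _ _)).
  - by move=> /gI' ->.
have -> : Num.sg (\prod_(i < k + m) \prod_(j < k + m | (i < j)%N) ((s j)%:R - (s i)%:R : R))
  = \prod_(i < k + m) \prod_(j < k + m) (-1) ^+ ((i < j) && (s j < s i))%N.
  rewrite sgp; apply: eq_bigr => i _; rewrite sgp big_mkcond; apply: eq_bigr => j _.
  case: ifP => //= ij; case: (ltngtP (s j) (s i)) => sji.
  - by rewrite ltr0_sg// subr_lt0 ltr_nat.
  - by rewrite gtr0_sg// subr_gt0 ltr_nat.
  - by move: ij; rewrite (sI _ _ (ord_inj sji)) ltnn.
rewrite big_split_ord/= [X in _ * X]big1 ?mulr1 => [|i _]; last first.
  rewrite big_split_ord/= [X in X * _]big1 ?mul1r => [|j _].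
    apply: big1 => j _; rewrite ltn_add2l !sr; case: ltnP => //= ij.
    by rewrite ltnNge ltnW ?gmono'.
  by rewrite ltnNge (leq_trans (ltnW (ltn_ord j)) (leq_addr _ _)).
rewrite -prodrXr; apply: eq_bigr => i _.
rewrite -prodrXr big_split_ord/= [X in X * _]big1 ?mul1r => [|j _]; last first.
  rewrite !sl; case: ltnP => //= ij.
  by rewrite ltnNge ltnW ?gmono.
by apply: eq_bigr => j _; rewrite sl sr (leq_trans (ltn_ord i) (leq_addr _ _)).
Qed.

End Perm.
End HodgeMx.

(** * Packing by counting lattice points *)

Section IntegerPoints.
Variables (R : realType) (n : nat).

Definition intmx m p (A : 'M[int]_(m, p)) : 'M[R]_(m, p) := map_mx intr A.

(* With A = L D U in Smith form, the integer vectors y U with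
   0 <= y_i < |D_ii| are pairwise incongruent modulo the row lattice of A;
   reduce each of them into the half-open parallelepiped. *)
Lemma integer_points (A : 'M[int]_n) :
  exists f : 'I_(`|\det A|)%N -> 'rV[int]_n, injective f /\
    forall c, exists t : 'rV[R]_n, (forall i, 0 <= t 0 i < 1) /\
      intmx (f c) = t *m intmx A.
Proof.
have [dA0|dA] := eqVneq (\det A) 0.
  by rewrite dA0; exists (fun=> 0); split => -[].
have [L uL [U uU [d _ defA]]] := int_Smith_normal_form A.
set D := \matrix_(i, j) _ in defA.
have DE : D = diag_mx (\row_i d`_i).
  by apply/matrixP => i j; rewrite !mxE.
have absdet (M : 'M[int]_n) : M \in unitmx -> `|\det M|%N = 1%N.
  move=> uM; have /eqP := congr1 (fun N => absz (\det N)) (mulmxV uM).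
  by rewrite det_mulmx abszM det1 muln_eq1 => /andP[/eqP].
have cardA : `|\det A|%N = (\prod_(i < n) `|(d`_i)%R|)%N.
  rewrite defA !det_mulmx !abszM (absdet L)// (absdet U)// mul1n muln1 DE det_diag.
  rewrite (big_morph absz abszM (erefl : absz 1 = 1%N)).
  by apply: eq_bigr => i _; rewrite mxE.
pose T := {dffun forall i : 'I_n, 'I_(`|(d`_i)%R|)%N}.
have cardT : #|T| = `|\det A|%N.
  by rewrite card_dep_ffun cardA foldrE big_map big_enum/=; apply: eq_bigr => i _; rewrite card_ord.
have uA : intmx A \in unitmx.
  by rewrite unitmxE unitfE det_map_mx intr_eq0.
pose y (c : T) : 'rV[int]_n := \row_i (c i : nat)%:Z.
pose t (c : T) : 'rV[R]_n := intmx (y c *m U) *m invmx (intmx A).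
pose z (c : T) : 'rV[int]_n := y c *m U - (\row_i Num.floor (t c 0 i)) *m A.
have zI : injective z.
  move=> c c' zz; pose w : 'rV[int]_n :=
    \row_i Num.floor (t c 0 i) - \row_i Num.floor (t c' 0 i).
  have yU : (y c - y c') *m U = w *m A.
    move: zz; rewrite /z /w !mulmxBl => zz.
    by apply/eqP; rewrite -subr_eq0 opprB [_ *m A - _]addrC addrACA zz addrACA subrr addNr addr0.
  have yD : y c - y c' = w *m L *m D.
    by rewrite -[LHS](mulmxK uU) yU defA -!mulmxA mulmxV// mulmx1.
  apply/ffunP => i; apply/val_inj/eqP; rewrite -eqz_nat -subr_eq0.
  have := congr1 (fun M : 'rV_n => M 0 i) yD; rewrite DE mul_mx_diag !mxE => E.
  have dv : (d`_i %| (c i)%:Z - (c' i)%:Z)%Z by rewrite E dvdz_mull.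
  have dp : (0 < `|(d`_i)%R|)%N by apply: leq_ltn_trans (ltn_ord (c i)).
  rewrite -eqz_mod_dvd -modz_abs -[X in _ == X]modz_abs !modz_small ?eqz_nat// in dv.
  by rewrite subr_eq0 eqz_nat.
  by rewrite /= ltz_nat.
  by rewrite /= ltz_nat.
have zin c : exists u : 'rV[R]_n, (forall i, 0 <= u 0 i < 1) /\
    intmx (z c) = u *m intmx A.
  exists (t c - \row_i (Num.floor (t c 0 i))%:~R); split=> [i|].
    rewrite !mxE; have := floor_itv (\sum_j intmx (y c *m U) 0 j * invmx (intmx A) j i).
    by rewrite subr_ge0 ltrBlDr intrD addrC => /andP[-> ->].
  rewrite mulmxBl /z /t mulmxKV// /intmx map_mxB map_mxM; congr (_ - _).
  by rewrite map_mxM; congr (_ *m _); apply/rowP => i; rewrite !mxE.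
exists (fun c => z (enum_val (cast_ord (esym cardT) c))); split=> [c c' /zI|c].
  by move=> /enum_val_inj /cast_ord_inj.
exact: zin.
Qed.

(** Parallelepiped j holds |\det (A j)| integer points by [integer_points], disjointness separates
    the points of different j, and all are among the (2B+1)^n integer points of the box about o. *)
Lemma int_packing (I : finType) (x : I -> 'rV[int]_n) (A : I -> 'M[int]_n)
    (o : 'rV[int]_n) (B : nat) :
  (forall j (t : 'rV[R]_n), (forall i, 0 <= t 0 i < 1) ->
    forall i, `|(intmx (x j) + t *m intmx (A j) - intmx o) 0 i| <= B%:R) ->
  (forall j j' (t t' : 'rV[R]_n), (forall i, 0 <= t 0 i < 1) ->
    (forall i, 0 <= t' 0 i < 1) ->
    intmx (x j) + t *m intmx (A j) = intmx (x j') + t' *m intmx (A j') -> j = j') ->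
  (\sum_j `|\det (A j)| <= (2 * B).+1 ^ n)%N.
Proof.
move=> inbox disj; pose f j := sval (cid (integer_points (A j))).
have Hf j : injective (f j) /\ forall c, exists t : 'rV[R]_n,
    (forall i, 0 <= t 0 i < 1) /\ intmx (f j c) = t *m intmx (A j).
  exact: (svalP (cid (integer_points (A j)))).
pose T : finType := {j : I & 'I_(`|\det (A j)|)%N}.
have cardT : #|{: T}| = (\sum_j `|\det (A j)|)%N.
  rewrite card_tagged sumnE big_map big_enum/=.
  by apply: eq_bigr => j _; rewrite card_ord.
pose p (c : T) : 'rV[int]_n := x (tag c) + f (tag c) (tagged c).
have pin c : exists t : 'rV[R]_n, (forall i, 0 <= t 0 i < 1) /\
    intmx (p c) = intmx (x (tag c)) + t *m intmx (A (tag c)).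
  have [_ /(_ (tagged c))[t [t01 ft]]] := Hf (tag c); exists t; split=> //.
  by rewrite /p -ft; exact: map_mxD.
have pbox c i : (`|((p c - o) ord0 i)%R| <= B)%N.
  have [t [t01 pt]] := pin c; have := inbox (tag c) _ t01 i.
  rewrite -pt -[_ - _]/(map_mx _ _ - map_mx _ _) -map_mxB mxE -intr_norm.
  by rewrite -[B%:R]/(B%:Z%:~R) ler_int -lez_nat abszE.
have pI : injective p.
  move=> c c' pp; have [t [t01 pt]] := pin c; have [t' [t01' pt']] := pin c'.
  have jj : tag c = tag c' by apply: (disj _ _ _ _ t01 t01'); rewrite -pt -pt' pp.
  case: c c' jj pp {pt pt'} => [j a] [j' a']/= jj; case: _ / jj a' => a'.
  by rewrite /p/= => /addrI /(proj1 (Hf j)) ->.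
pose g (c : T) : {ffun 'I_n -> 'I_(2 * B).+1} :=
  [ffun i => inord (`|((p c - o) ord0 i + B%:Z)%R|)%N].
have gI : injective g.
  move=> c c' /ffunP gg; apply: pI; apply/rowP => i.
  have := gg i; rewrite !ffunE => /(congr1 val) /=.
  have := pbox c i; have := pbox c' i.
  rewrite !mxE; move: (p c 0 i) (p c' 0 i) (o 0 i) => a b u hb ha.
  rewrite !inordK; lia.
by have := leq_card g gI; rewrite -cardT card_ffun !card_ord.
Qed.
End IntegerPoints.

(** * From integer parallelepipeds to disjoint real simplices *)

Section Packing.
Variables (R : realType) (n : nat).

Lemma cvg_detmx (T : Type) (F : set_system T) {FF : Filter F} (A : T -> 'M[R]_n)
    (B : 'M[R]_n) :
  (forall i j, A x i j @[x --> F] --> B i j) -> \det (A x) @[x --> F] --> \det B.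
Proof.
move=> AB; rewrite /determinant.
apply: cvg_big => [|s _]; first exact: add_continuous.
apply: cvgM; first exact: cvg_cst.
by apply: cvg_big => [|i _]; [exact: mul_continuous|exact: AB].
Qed.

Definition nfloor (N : nat) (b : R) : int := Num.floor (N%:R * b).

Lemma nfloor_bound N b : `|(nfloor N b)%:~R - N%:R * b| <= 1.
Proof.
have := floor_itv (N%:R * b); rewrite -/(nfloor N b) intrD => /andP[h1 h2].
by rewrite ler_norml; lra.
Qed.

Lemma cvg_nfloor b : (nfloor N b)%:~R / N%:R @[N --> \oo] --> b.
Proof.
apply/cvgrPdist_le => e e0.
near=> N; have N0 : 0 < N%:R :> R by rewrite ltr0n; near: N; exists 1%N.
have -> : b - (nfloor N b)%:~R / N%:R = (N%:R * b - (nfloor N b)%:~R) / N%:R.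
  by field; rewrite gt_eqF.
rewrite normrM normfV [`|N%:R|]gtr0_norm// ler_pdivrMr// distrC.
apply: (le_trans (nfloor_bound _ _)).
rewrite mulrC -ler_pdivrMr// div1r; apply/ltW/(lt_le_trans (truncnS_gt _)).
rewrite ler_nat; near: N; exact: nbhs_infty_ge.
Unshelve. all: by end_near. Qed.

Lemma mulmx_entry_bound m (u : 'rV[R]_m) p (A : 'M[R]_(m, p)) (a b : R) j :
  0 <= a -> (forall i, `|u 0 i| <= a) -> (forall i, `|A i j| <= b) ->
  `|(u *m A) 0 j| <= m%:R * (a * b).
Proof.
move=> a0 ua Ab; rewrite mxE (le_trans (ler_norm_sum _ _ _))//.
rewrite mulr_natl -[m in leRHS]card_ord -sumr_const; apply: ler_sum => i _.
by rewrite normrM ler_pM.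
Qed.

Definition open_simplex (x : 'rV[R]_n) (E : 'M[R]_n) : set 'rV[R]_n :=
  [set y | exists l : 'rV[R]_n, (forall i, 0 < l 0 i) /\ \sum_i l 0 i < 1 /\
     y = x + l *m E].

(* For large N the integer parallelepiped obtained by rounding N times the
   small parallelepiped x + a (1 + [0,1)^n) E still lies in N times the open
   simplex. *)
Lemma rounded_in_simplex (x : 'rV[R]_n) (E : 'M[R]_n) (a := (n.*2.+1)%:R^-1 : R) :
  \det E != 0 ->
  \forall N \near \oo, forall t : 'rV[R]_n, (forall i, 0 <= t 0 i < 1) ->
   open_simplex x E (N%:R^-1 *: (map_mx intr (map_mx (nfloor N) (x + const_mx a *m E))
     + t *m map_mx intr (map_mx (nfloor N) (a *: E)))).
Proof.
move=> dE; have uE : E \in unitmx by rewrite unitmxE unitfE.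
have a0 : 0 < a by rewrite invr_gt0 ltr0n.
(* Before rounding the coordinates lie in [a, 2a], so each exceeds 0 by at least a and their sum is
   below 1 = (2n+1) a by at least a. Rounding errors below a / (n+1) fit in both gaps. *)
have aE : a * n.*2.+1%:R = 1 by rewrite /a mulVf// pnatr_eq0.
pose M := \sum_i \sum_j `|invmx E i j|.
have Mb i j : `|invmx E i j| <= M.
  rewrite /M (bigD1 i)//= (bigD1 j)//= -addrA lerDl addr_ge0 ?sumr_ge0// => k _.
  by rewrite sumr_ge0.
(* The rounding error [e] has entries at most 1 + n; for N > K its coordinates along E, divided by
   N, fall below a / (n+1). *)
pose K := n%:R * ((1 + n%:R) * M) * n.+1%:R / a.
near=> N => t t01.
have N0 : 0 < N%:R :> R by rewrite ltr0n; near: N; exists 1%N.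
have NK : K < N%:R.
  apply: (lt_le_trans (truncnS_gt _)); rewrite ler_nat; near: N; exact: nbhs_infty_ge.
set P := map_mx _ (map_mx _ (x + _)); set Q := map_mx _ (map_mx _ (a *: E)).
pose e : 'rV[R]_n := (P - N%:R *: (x + const_mx a *m E)) + t *m (Q - N%:R *: (a *: E)).
have eb i : `|e 0 i| <= 1 + n%:R.
  rewrite mxE (le_trans (ler_normD _ _))// lerD//.
    by rewrite !mxE; have := nfloor_bound N ((x + const_mx a *m E) 0 i); rewrite !mxE.
  rewrite -[n%:R]mulr1 -[X in _ * X]mulr1; apply: mulmx_entry_bound => // j.
    by have /andP[h1 h2] := t01 j; rewrite ger0_norm// ltW.
  by rewrite !mxE; have := nfloor_bound N ((a *: E) j i); rewrite !mxE.
pose r := N%:R^-1 *: (e *m invmx E).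
have rb i : `|r 0 i| * n.+1%:R < a.
  rewrite mxE normrM normfV [`|N%:R|]gtr0_norm//.
  rewrite -mulrA mulrC ltr_pdivrMr// [ltRHS]mulrC.
  rewrite -(ltr_pdivrMr _ _ a0); apply: le_lt_trans NK.
  rewrite /K ler_pM2r ?invr_gt0// ler_pM2r ?ltr0n//.
  apply: mulmx_entry_bound => // ; exact: addr_ge0.
exists (const_mx a + a *: t + r); split=> [i|].
  rewrite !mxE; have /andP[t0 _] := t01 i; have := rb i; rewrite !mxE => rbi.
  have at0 : 0 <= a * t 0 i by rewrite mulr_ge0// ltW.
  have : `|r 0 i| < a.
    by apply: le_lt_trans (rb i); rewrite -[leLHS]mulr1 ler_wpM2l// ler1n.
  rewrite ltr_norml !mxE => /andP[h _].
  by rewrite -addrA; lra.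
split; last first.
  have eE : e = (P + t *m Q) - N%:R *: (x + const_mx a *m E + a *: (t *m E)).
    rewrite /e; move: (x + const_mx a *m E) => X.
    by rewrite mulmxBr scalerDr opprD -!scalemxAr addrACA.
  rewrite !mulmxDl /r -!scalemxAl mulmxKV// eE scalerBr [X in _ - X]scalerA.
  by rewrite mulVf ?gt_eqF// scale1r !addrA addrAC subrr add0r.
have n1 : 0 < n.+1%:R :> R by rewrite ltr0n.
have : \sum_i (const_mx a + a *: t + r) 0 i <= \sum_(i < n) (2 * a + a / n.+1%:R).
  apply: ler_sum => i _.
  have rb' : `|r 0 i| <= a / n.+1%:R by rewrite ler_pdivlMr// ltW.
  have /andP[t0 /ltW t1] := t01 i.
  have at1 : a * t 0 i <= a by rewrite ler_piMr// ltW.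
  have -> (v : 'rV[R]_n) : (const_mx a + a *: t + v) 0 i = a + a * t 0 i + v 0 i.
    by rewrite !mxE.
  move: rb'; rewrite ler_norml => /andP[_ h].
  by rewrite mulr_natl mulr2n lerD// lerD.
move=> h; apply: (le_lt_trans h); rewrite sumr_const card_ord -[_ *+ n]mulr_natl.
have na : n%:R * (a / n.+1%:R) = a - a / n.+1%:R.
  by rewrite -natr1 in n1 *; field; rewrite gt_eqF.
have a1 : 0 < a / n.+1%:R by rewrite divr_gt0.
have := aE; rewrite -natr1 -muln2 natrM => aE'.
rewrite mulrDr na -[ltRHS]aE'.
have -> : a * (n%:R * 2 + 1) = n%:R * (2 * a) + a by ring.
by rewrite addrA ltrBlDr ltrDl.
Unshelve. all: by end_near. Qed.

(** Divide [int_packing] by N^n and let N tend to infinity: the rounded determinants tend to those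
    of a E, the box to (2h)^n. Using only the parallelepiped shrunk by a = 1 / (2n+1) costs the
    factor (2n+1)^n. *)
Lemma simplex_packing (I : finType) (x : I -> 'rV[R]_n) (E : I -> 'M[R]_n)
    (o : 'rV[R]_n) (h : R) : 0 <= h ->
  (forall j, \det (E j) != 0) ->
  (forall j y, open_simplex (x j) (E j) y -> forall i, `|(y - o) 0 i| <= h) ->
  (forall j j' y, open_simplex (x j) (E j) y -> open_simplex (x j') (E j') y ->
    j = j') ->
  \sum_j `|\det (E j)| <= (2 * (n.*2.+1)%:R * h) ^+ n.
Proof.
move=> h0 dE inbox disj; pose a : R := (n.*2.+1)%:R^-1.
have a0 : 0 < a by rewrite invr_gt0 ltr0n.
pose A (N : nat) j : 'M[int]_n := map_mx (nfloor N) (a *: E j).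
pose X (N : nat) j : 'rV[int]_n := map_mx (nfloor N) (x j + const_mx a *m E j).
(* One unit makes the truncation an upper bound of N h, the other pays for rounding the centre N
   o. *)
pose B (N : nat) : nat := (Num.truncn (N%:R * h)).+2.
have bnd : \forall N \near \oo, (\sum_j `|\det (A N j)| <= (2 * B N).+1 ^ n)%N.
  have ins : \forall N \near \oo, forall j (t : 'rV[R]_n), (forall i, 0 <= t 0 i < 1) ->
     open_simplex (x j) (E j) (N%:R^-1 *: (map_mx intr (X N j) + t *m map_mx intr (A N j))).
    apply: filter_forall => j; exact: rounded_in_simplex.
  near=> N.
  have N0 : 0 < N%:R :> R by rewrite ltr0n; near: N; exists 1%N.
  have insN : forall j (t : 'rV[R]_n), (forall i, 0 <= t 0 i < 1) ->
     open_simplex (x j) (E j) (N%:R^-1 *: (map_mx intr (X N j) + t *m map_mx intr (A N j))).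
    by near: N.
  apply: (@int_packing R _ _ (X N) _ (map_mx (nfloor N) o)).
    move=> j t t01 i; have := inbox _ _ (insN j t t01) i.
    rewrite /intmx; move: (map_mx intr (X N j) + _) => Y Yi.
    have -> : (Y - map_mx intr (map_mx (nfloor N) o)) 0 i =
      N%:R * (N%:R^-1 *: Y - o) 0 i + (N%:R * o 0 i - (nfloor N (o 0 i))%:~R).
      by rewrite !mxE mulrBr mulrA mulfV ?gt_eqF// mul1r addrA subrK.
    rewrite (le_trans (ler_normD _ _))// /B -natr1 lerD//; last first.
      by rewrite distrC nfloor_bound.
    rewrite normrM [`|N%:R|]gtr0_norm// ltW// (le_lt_trans _ (truncnS_gt _))//.
    by rewrite ler_pM2l.
  move=> j j' t t' t01 t01' tt; apply: disj (insN j t t01) _.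
  by rewrite [map_mx _ _ + _]tt; exact: insN.
have natdet N j : (`|\det (A N j)|%N)%:R = `|\det (map_mx intr (A N j) : 'M[R]_n)|.
  by rewrite natr_absz det_map_mx intr_norm.
have lim1 : \sum_j `|\det (N%:R^-1 *: (map_mx intr (A N j) : 'M[R]_n))| @[N --> \oo]
    --> \sum_j `|\det (a *: E j)|.
  apply: cvg_big => [|j _]; first exact: add_continuous.
  apply: cvg_norm; apply: (@cvg_detmx nat eventually eventually_filter) => i l; under eq_fun do rewrite !mxE mulrC.
  by rewrite mxE; exact: cvg_nfloor.
(* 2 B + 1 is at most 2 N h + 5, so 7 / N leaves room. *)
have lim2 : (2 * h + 7 * N%:R^-1) ^+ n @[N --> \oo] --> (2 * h) ^+ n.
  have : (2 * h + 7 * N%:R^-1) @[N --> \oo] --> 2 * h + 7 * 0.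
    apply: cvgD; first exact: cvg_cst.
    apply: cvgM; first exact: cvg_cst.
    rewrite -cvg_shiftS; exact: cvg_harmonic.
  rewrite mulr0 addr0 => H.
  exact: (cvg_comp _ (fun z : R => z ^+ n) H (@exprn_continuous R n _)).
have : \sum_j `|\det (a *: E j)| <= (2 * h) ^+ n.
  apply: ler_cvg_to lim1 lim2 _; near=> N.
  have N0 : 0 < N%:R :> R by rewrite ltr0n; near: N; exists 1%N.
  have : (\sum_j `|\det (A N j)| <= (2 * B N).+1 ^ n)%N by near: N.
  rewrite -(ler_nat R) natr_sum natrX.
  under eq_bigr do rewrite natdet.
  under [in X in _ -> X <= _]eq_bigr do rewrite detZ normrM normrX normfV [`|N%:R|]gtr0_norm//.
  rewrite -mulr_sumr => le.
  rewrite exprVn mulrC ler_pdivrMr ?exprn_gt0// -exprMn; apply: (le_trans le).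
  have tr : (Num.truncn (N%:R * h))%:R <= N%:R * h.
    by have /andP[] := truncn_itv (mulr_ge0 (ltW N0) h0).
  have le' : (2 * B N).+1%:R <= (2 * h + 7 * N%:R^-1) * N%:R.
    rewrite mulrDl -[7 * _ * _]mulrA mulVf ?gt_eqF// /B -natr1 natrM -natr1 -natr1; lra.
  by apply: lerXn2r; rewrite ?nnegrE ?(le_trans _ le').
under eq_bigr do rewrite detZ normrM normrX gtr0_norm//.
rewrite -mulr_sumr exprVn mulrC ler_pdivrMr ?exprn_gt0 ?ltr0n// -exprMn.
by rewrite mulrAC.
Unshelve. all: by end_near. Qed.

End Packing.

(** * Barycentric coordinates and circumcenters *)

Section Simplices.
Variables (R : realType) (n : nat).
Local Notation point := 'rV[R]_n.
Implicit Types (s t xs : seq point) (x y z c : point).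

Definition rowsmx k (vs : seq point) : 'M[R]_(k, n) := \matrix_(i < k) nth 0 vs i.

Lemma edotE (u v : point) : edot u v = (u *m v^T) 0 0.
Proof. by rewrite /edot mxE; apply: eq_bigr => i _; rewrite mxE. Qed.

Lemma gram_rowsmx k (vs : seq point) (i j : 'I_k) :
  (rowsmx k vs *m (rowsmx k vs)^T) i j = edot (nth 0 vs i) (nth 0 vs j).
Proof. by rewrite /edot !mxE; apply: eq_bigr => l _; rewrite !mxE. Qed.

Lemma size_elist x0 vs : size (elist (x0 :: vs)) = size vs.
Proof. by rewrite size_map. Qed.

Lemma nth_elist x0 vs i : (i < size vs)%N ->
  nth 0 (elist (x0 :: vs)) i = nth 0 vs i - x0.
Proof. by move=> iv; rewrite (nth_map 0). Qed.

Lemma volE k xs : size (elist xs) = k ->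
  vol xs = Num.sqrt (\det (rowsmx k (elist xs) *m (rowsmx k (elist xs))^T)) / k`!%:R.
Proof.
move=> <-; rewrite /vol; congr (Num.sqrt (\det _) / _).
by apply/matrixP => i j; rewrite mxE gram_rowsmx.
Qed.

Lemma sdetE (vs : seq point) : sdet vs = \det (rowsmx n vs).
Proof. by congr (\det _); apply/matrixP => i j; rewrite !mxE. Qed.

Lemma rowsmx_cat k m (a b : seq point) : size a = k ->
  rowsmx (k + m) (a ++ b) = col_mx (rowsmx k a) (rowsmx m b).
Proof.
move=> ak; apply/row_matrixP => i; rewrite -[i]splitK /unsplit.
case: (fintype.split i) => j.
  by rewrite rowKu; apply/rowP => l; rewrite !mxE nth_cat ak /= ltn_ord.
rewrite rowKd; apply/rowP => l; rewrite !mxE nth_cat ak /=.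
by rewrite ltnNge leq_addr/= addKn.
Qed.

(** Passage to coordinates along the edges from the first vertex, where affine questions become
    matrix equations; [bary_of_row] goes back. *)
Lemma bary_row x0 vs (l : 'I_(size vs).+1 -> R) : \sum_i l i = 1 ->
  \sum_i l i *: nth 0 (x0 :: vs) i =
  x0 + (\row_i l (lift ord0 i)) *m rowsmx (size vs) (elist (x0 :: vs)).
Proof.
rewrite !big_ord_recl/= => l1; rewrite mulmx_sum_row.
have hx : x0 = l ord0 *: x0 + \sum_(i < size vs) l (lift ord0 i) *: x0.
  by rewrite -scaler_suml -scalerDl l1 scale1r.
rewrite [X in _ = X + _]hx -addrA -big_split/=.
congr (_ + _); apply: eq_bigr => i _; rewrite mxE rowK nth_elist// scalerBr.
by rewrite [RHS]addrC subrK.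
Qed.

Definition bary_of_row m (u : 'rV[R]_m) (i : 'I_m.+1) : R :=
  if unlift ord0 i is Some j then u 0 j else 1 - \sum_j u 0 j.

Lemma bary_of_row_sum m (u : 'rV[R]_m) : \sum_i bary_of_row u i = 1.
Proof.
rewrite big_ord_recl /bary_of_row unlift_none.
rewrite -[RHS](subrK (\sum_j u 0 j)); congr (_ + _).
by apply: eq_bigr => i _; rewrite liftK.
Qed.

Lemma bary_of_rowE x0 vs (u : 'rV[R]_(size vs)) :
  \sum_i bary_of_row u i *: nth 0 (x0 :: vs) i =
  x0 + u *m rowsmx (size vs) (elist (x0 :: vs)).
Proof.
rewrite bary_row ?bary_of_row_sum//; congr (_ + _ *m _).
by apply/rowP => i; rewrite mxE /bary_of_row liftK.
Qed.

Lemma aff_row x0 vs y : aff (x0 :: vs) y <->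
  exists u, y = x0 + u *m rowsmx (size vs) (elist (x0 :: vs)).
Proof.
split=> [[l [l1 ->]]|[u ->]]; first by rewrite (bary_row _ l1); eexists.
by exists (bary_of_row u); rewrite bary_of_row_sum bary_of_rowE.
Qed.

Lemma conv_row x0 vs y : Defs.conv (x0 :: vs) y <->
  exists u : 'rV_(size vs), (forall i, 0 <= u 0 i) /\ \sum_i u 0 i <= 1 /\
    y = x0 + u *m rowsmx (size vs) (elist (x0 :: vs)).
Proof.
split=> [[l [l0 [l1 ->]]]|[u [u0 [u1 ->]]]].
  rewrite (bary_row _ l1); eexists; split; last split; last by [].
    by move=> i; rewrite mxE.
  by rewrite -l1 big_ord_recl; under eq_bigr do rewrite mxE; rewrite lerDr.
exists (bary_of_row u); rewrite bary_of_row_sum bary_of_rowE; split=> // i.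
by rewrite /bary_of_row; case: unliftP => [j _|_]//; rewrite subr_ge0.
Qed.

Lemma relint_row x0 vs (u : 'rV_(size vs)) :
  (forall i, 0 < u 0 i) -> \sum_i u 0 i < 1 ->
  relint (x0 :: vs) (x0 + u *m rowsmx (size vs) (elist (x0 :: vs))).
Proof.
move=> u0 u1; exists (bary_of_row u); rewrite bary_of_row_sum bary_of_rowE.
split=> // i; rewrite /bary_of_row; case: unliftP => [j _|_]//.
by rewrite subr_gt0.
Qed.

Lemma mem_conv xs x : x \in xs -> Defs.conv xs x.
Proof.
move=> xxs; have ix : (index x xs < size xs)%N by rewrite index_mem.
exists (fun i => (i == Ordinal ix)%:R); split; first by move=> i; rewrite ler0n.
split; rewrite (bigD1 (Ordinal ix))//= eqxx.
  by rewrite big1 ?addr0// => i /negbTE ->.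
by rewrite scale1r nth_index// big1 ?addr0// => i /negbTE ->; rewrite scale0r.
Qed.

Lemma conv_conv xs t y : (forall x, x \in t -> Defs.conv xs x) ->
  Defs.conv t y -> Defs.conv xs y.
Proof.
move=> txs [l [l0 [l1 ->]]].
have tm (i : 'I_(size t)) : Defs.conv xs (nth 0 t i) by apply: txs; rewrite mem_nth.
pose m i := sval (cid (tm i)).
have mP i : (forall j, 0 <= m i j) /\ \sum_j m i j = 1 /\
    nth 0 t i = \sum_j m i j *: nth 0 xs j := svalP (cid (tm i)).
exists (fun j => \sum_i l i * m i j); split.
  by move=> j; apply: sumr_ge0 => i _; rewrite mulr_ge0//; case: (mP i).
split.
  rewrite exchange_big/= -[RHS]l1; apply: eq_bigr => i _.
  by rewrite -mulr_sumr (mP i).2.1 mulr1.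
under [RHS]eq_bigr do rewrite scaler_suml.
rewrite [RHS]exchange_big/=; apply: eq_bigr => i _.
rewrite {1}(mP i).2.2 scaler_sumr; apply: eq_bigr => j _.
by rewrite scalerA.
Qed.

(** Extension by zero of coordinates on a face; the sum over fibres takes care of repeated vertices.
    It lets points of different faces be compared through uniqueness of coordinates on xs. *)
Lemma reindex_bary xs t (l : 'I_(size t) -> R) : {subset t <= xs} ->
  exists l' : 'I_(size xs) -> R,
    [/\ \sum_i l' i = \sum_i l i,
        \sum_i l' i *: nth 0 xs i = \sum_i l i *: nth 0 t i,
        forall i : 'I_(size xs), nth 0 xs i \notin t -> l' i = 0 &
        uniq t -> uniq xs -> forall (i : 'I_(size xs)) (j : 'I_(size t)),
          nth 0 xs i = nth 0 t j -> l' i = l j].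
Proof.
move=> txs.
have it (i : 'I_(size t)) : (index (nth 0%R t i) xs < size xs)%N.
  by rewrite index_mem txs// mem_nth.
pose f i := Ordinal (it i).
have fE i : nth 0 xs (f i) = nth 0 t i by rewrite nth_index// txs// mem_nth.
exists (fun j => \sum_(i | f i == j) l i); split.
- by rewrite [RHS](partition_big f predT).
- rewrite [RHS](partition_big f predT)//=; apply: eq_bigr => j _.
  by rewrite scaler_suml; apply: eq_bigr => i /eqP <-; rewrite fE.
- move=> i it'; rewrite big_pred0// => j; apply: contraNF it' => /eqP <-.
  by rewrite fE mem_nth.
- move=> ut uxs i j ij; rewrite (big_pred1 j)// => j'; rewrite /= -val_eqE /=.
  have ifj : f j = i.
    by apply/val_inj => /=; rewrite -ij index_uniq.
  apply/eqP/eqP => [fj|->]; last exact: (congr1 val ifj).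
  have : nth 0 t j' = nth 0 t j by rewrite -fE -[in RHS]fE ifj; congr nth.
  by move=> /eqP; rewrite nth_uniq// => /eqP/val_inj.
Qed.

Lemma aff_sub xs t y : {subset t <= xs} -> aff t y -> aff xs y.
Proof.
move=> txs [l [l1 ->]]; have [l' [h1 h2 _ _]] := reindex_bary l txs.
by exists l'; rewrite h1 h2.
Qed.

(** [well_centered] speaks of sublists of s in the order of s, whereas a chain lists tau and then
    the other vertices in any order. *)
Lemma perm_circumcenter xs t : perm_eq xs t -> circumcenter xs = circumcenter t.
Proof.
move=> xt; congr (xget 0 _); apply/funext => c; apply/propext.
have H a b : perm_eq a b -> is_circumcenter a c -> is_circumcenter b c.
  move=> ab [ac eqa]; split.
    by apply: aff_sub ac => x; rewrite (perm_mem ab).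
  move=> x; case: b ab => [|b0 b] ab // xb.
  by rewrite eqa ?(perm_mem ab)// [in RHS]eqa// (perm_mem ab) mem_head.
by split; apply: H; rewrite // perm_sym.
Qed.

Lemma enorm_sqr (u : point) : enorm u ^+ 2 = edot u u.
Proof.
by rewrite sqr_sqrtr// /edot sumr_ge0// => i _; rewrite -expr2 sqr_ge0.
Qed.

Lemma enorm_ge0 (u : point) : 0 <= enorm u. Proof. exact: sqrtr_ge0. Qed.

Lemma abs_coord_le_enorm (u : point) i : `|u 0 i| <= enorm u.
Proof.
rewrite -sqrtr_sqr ler_sqrt.
  rewrite /edot (bigD1 i)//= -expr2 lerDl sumr_ge0// => j _.
  by rewrite -expr2 sqr_ge0.
by rewrite /edot sumr_ge0// => j _; rewrite -expr2 sqr_ge0.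
Qed.

Lemma edot_subr x c : edot (x - c) (x - c) = edot x x - 2 * edot x c + edot c c.
Proof.
rewrite /edot mulr_sumr -sumrB -big_split/=; apply: eq_bigr => i _.
by rewrite !mxE; ring.
Qed.

Lemma edotBl x y c : edot (x - y) c = edot x c - edot y c.
Proof. by rewrite /edot -sumrB; apply: eq_bigr => i _; rewrite !mxE mulrBl. Qed.

Lemma edotC x y : edot x y = edot y x.
Proof. by apply: eq_bigr => i _; rewrite mulrC. Qed.

(** The terms quadratic in c cancel. Circumcenters thus solve linear equations, and subtracting two
    such equations will give orthogonality. *)
Lemma equidistant_edot x y c : enorm (x - c) = enorm (y - c) <->
  2 * edot (x - y) c = edot x x - edot y y.
Proof.
split=> [/(congr1 (fun r => r ^+ 2))|H].
  by rewrite !enorm_sqr !edot_subr edotBl => H; lra.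
by congr Num.sqrt; rewrite !edot_subr; rewrite edotBl in H; lra.
Qed.

(** [circumcenter] is a choice with default 0, so nothing is known of it until a center has been
    exhibited. *)
Lemma ex_circumcenter x0 vs (E := rowsmx (size vs) (elist (x0 :: vs))) :
  (forall u : 'rV_(size vs), u *m E = 0 -> u = 0) ->
  is_circumcenter (x0 :: vs) (circumcenter (x0 :: vs)).
Proof.
move=> free; have uG : E *m E^T \in unitmx.
  by rewrite unitmxE unitfE gt_eqF// gram_det_gt0.
pose d : 'rV[R]_(size vs) := \row_i (edot (nth 0 vs i - x0) (nth 0 vs i - x0) / 2).
(* Solution of (c - x0).(x_i - x0) = |x_i - x0|^2 / 2 with c - x0 in the row space of E. *)
pose c := x0 + d *m invmx (E *m E^T) *m E.
suff cc : is_circumcenter (x0 :: vs) c by apply: xgetPex; exists c.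
split; first by apply/aff_row; eexists.
move=> x; rewrite inE => /predU1P[->//|xvs]; apply/equidistant_edot => /=.
have xi : (index x vs < size vs)%N by rewrite index_mem.
pose i := Ordinal xi; have nx : nth 0 vs i = x by rewrite nth_index.
have : (d *m invmx (E *m E^T) *m E *m E^T) 0 i = d 0 i.
  by rewrite -[_ *m E *m _]mulmxA mulmxKV.
have rE : row i E = x - x0 by rewrite rowK nth_elist// nx.
have -> (w : point) : (w *m E^T) 0 i = edot w (x - x0).
  rewrite -rE /edot mxE; apply: eq_bigr => l _; by rewrite !mxE.
have -> : d *m invmx (E *m E^T) *m E = c - x0 by rewrite /c addrC addKr.
rewrite [d 0 i]mxE nx edot_subr edotC !edotBl ![edot _ (c - x0)]edotC !edotBl.
rewrite ![edot c _]edotC [edot x0 x]edotC; lra.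
Qed.

End Simplices.

(** * Lipschitz bounds *)

Section Lipschitz.
Variables (R : realType) (n : nat).

Lemma mxnormP (x : 'rV[R]_n) (e : R) : 0 <= e ->
  (`|x| <= e) <-> (forall i, `|x 0 i| <= e).
Proof.
move=> e0; rewrite -[`|x|]/(mx_norm x) mx_normrE; split.
  by move=> /bigmax_leP[_ xe] i; exact: (xe (0, i)).
by move=> xe; apply/bigmax_leP; split=> // -[i j] _ /=; rewrite ord1.
Qed.

Lemma coord_MVT (f : 'rV[R]_n -> R) (j : 'I_n) (y : 'rV[R]_n) (d M : R) :
  (forall t, (0 <= t <= d) || (d <= t <= 0) -> derivable f (y + t *: delta_mx 0 j) (delta_mx 0 j) /\
     `|'D_(delta_mx 0 j) f (y + t *: delta_mx 0 j)| <= M) ->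
  `|f (y + d *: delta_mx 0 j) - f y| <= M * `|d|.
Proof.
move=> H; pose v : 'rV[R]_n := delta_mx 0 j.
pose g (t : R) := f (y + t *: v).
have dg t : (0 <= t <= d) || (d <= t <= 0) -> is_derive t (1 : R) g ('D_v f (y + t *: v)).
  move=> td; have [df _] := H t td.
  have E : (fun h : R => h^-1 *: ((g \o shift t) (h *: (1:R)) - g t)) =
           (fun h : R => h^-1 *: ((f \o shift (y + t *: v)) (h *: v) - f (y + t *: v))).
    apply/funext => h; rewrite /g /=; congr (_ *: (f _ - _)).
    by rewrite scalerDl [h *: 1]mulr1 addrCA addrA.
  apply: DeriveDef; first by rewrite /derivable E.
  by rewrite /derive E.
have bound t : (0 <= t <= d) || (d <= t <= 0) -> `|'D_v f (y + t *: v)| <= M by move=> /H[].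
have inter a b : a <= b -> (forall t, a <= t <= b -> (0 <= t <= d) || (d <= t <= 0)) ->
    `|g b - g a| <= M * (b - a).
  move=> ab tab; have [||c cab ->] := @MVT_segment R g (fun t => 'D_v f (y + t *: v)) a b ab.
  - move=> t; rewrite in_itv/= => /andP[/ltW at0 /ltW tb]; apply: dg; apply: tab.
    by rewrite at0 tb.
  - apply: derivable_within_continuous => t; rewrite in_itv/= => tt.
    by have [] := dg t (tab t tt).
  - rewrite normrM [`|b - a|]ger0_norm ?subr_ge0// ler_wpM2r ?subr_ge0//.
    by apply: bound; apply: tab; move: cab; rewrite in_itv.
have -> : f y = g 0 by rewrite /g scale0r addr0.
rewrite -/(g d); have [d0|d0] := leP 0 d.
  rewrite (le_trans (inter 0 d d0 _))//; last by rewrite subr0 ger0_norm.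
  by move=> t ->.
rewrite distrC (le_trans (inter d 0 (ltW d0) _))//; last by rewrite sub0r ltr0_norm.
by move=> t ->; rewrite orbT.
Qed.

(** One coordinate is changed at a time, so partial derivatives suffice; the path from y to x stays
    in the box. [w k] already has the first k coordinates of x. *)
Lemma box_lipschitz (f : 'rV[R]_n -> R) (c : 'rV[R]_n) (r M : R) : 0 <= M ->
  (forall z : 'rV[R]_n, (forall i, `|z 0 i - c 0 i| < r) -> forall j,
     derivable f z (delta_mx 0 j) /\ `|'D_(delta_mx 0 j) f z| <= M) ->
  forall x y : 'rV[R]_n, (forall i, `|x 0 i - c 0 i| < r) -> (forall i, `|y 0 i - c 0 i| < r) ->
  `|f x - f y| <= n%:R * M * `|x - y|.
Proof.
move=> M0 H x y xc yc.
pose w (k : nat) : 'rV[R]_n := \row_i (if (i < k)%N then x 0 i else y 0 i).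
have step k : (k <= n)%N -> `|f (w k) - f y| <= k%:R * M * `|x - y|.
  elim: k => [_|k IH kn].
    have -> : w 0%N = y by apply/rowP => i; rewrite mxE.
    by rewrite subrr normr0 !mul0r.
  pose j := Ordinal kn; pose d := x 0 j - y 0 j.
  have wS : w k.+1 = w k + d *: delta_mx 0 j.
    apply/rowP => i; rewrite !mxE eqxx/= ltnS leq_eqVlt -[(i == k :> nat)]/(i == j).
    have [->|ij] := eqVneq i j; first by rewrite ltnn mulr1 /d addrC subrK.
    by rewrite mulr0 addr0.
  have dxy : `|d| <= `|x - y|.
    have := (mxnormP (x - y) (normr_ge0 _)).1 (lexx _) j.
    by rewrite !mxE.
  have -> : f (w k.+1) - f y = (f (w k.+1) - f (w k)) + (f (w k) - f y).
    by rewrite addrA subrK.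
  rewrite (le_trans (ler_normD _ _))// -natr1 mulrDl mul1r mulrDl addrC lerD//.
    by apply: IH; exact: ltnW.
  rewrite wS (@le_trans _ _ (M * `|d|))// ?ler_wpM2l//.
  apply: coord_MVT => t td; apply: H => i.
  have -> (u : 'rV[R]_n) : (u + t *: delta_mx 0 j) 0 i = u 0 i + t * (i == j)%:R.
    by rewrite !mxE eqxx.
  have wk : `|w k 0 i - c 0 i| < r by rewrite mxE; case: ifP.
  have [->|ij] := eqVneq i j; last by rewrite mulr0 addr0.
  have -> : w k 0 j = y 0 j by rewrite mxE ltnn.
  rewrite mulr1; have := xc j; have := yc j; move: td; rewrite /d.
  move: (x 0 j) (y 0 j) (c 0 j) => a b u.
  by rewrite !ltr_norml => /orP[]/andP[? ?] /andP[? ?] /andP[? ?]; lra.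
have -> : f x - f y = f (w n) - f y.
  by congr (f _ - _); apply/rowP => i; rewrite mxE ltn_ord.
exact: step.
Qed.

Lemma cvg_sumr (V : normedModType R) (I : finType) (T : Type) (F : set_system T)
    (FF : Filter F) (f : I -> T -> V) (a : I -> V) :
  (forall i, f i x @[x --> F] --> a i) -> \sum_i f i x @[x --> F] --> \sum_i a i.
Proof. by move=> fa; apply: cvg_big => //; exact: add_continuous. Qed.

Lemma compact_conv (s : seq 'rV[R]_n) : compact (Defs.conv s).
Proof.
pose S := [set l : 'rV[R]_(size s) | (forall i, 0 <= l 0 i) /\ \sum_i l 0 i = 1].
pose F (l : 'rV[R]_(size s)) := \sum_i l 0 i *: nth 0 s i.
have -> : Defs.conv s = F @` S.
  rewrite eqEsubset; split=> [y [l [l0 [l1 ->]]]|_ [l [l0 l1] <-]].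
    exists (\row_i l i); last by apply: eq_bigr => i _; rewrite mxE.
    by split=> [i|]; [rewrite mxE|rewrite -l1; apply: eq_bigr => i _; rewrite mxE].
  by exists (fun i => l 0 i).
apply: continuous_compact.
  apply: continuous_subspaceT => l; apply: (@cvg_sumr _ _ _ (nbhs l) (nbhs_filter l)) => i.
  by apply: cvgZr_tmp; exact: coord_continuous.
have cube : compact [set l : 'rV[R]_(size s) | forall i, l ord0 i \in `[(0:R), 1]].
  apply: (@rV_compact _ _ (fun=> `[(0:R), 1]%classic)).
  by move=> _; exact: segment_compact.
apply: subclosed_compact cube _; last first.
  move=> l [l0 l1] i; rewrite /= in_itv/= l0/= -l1 (bigD1 i)//= lerDl sumr_ge0//.
have -> : S = (\bigcap_(i in [set: 'I_(size s)]) ((fun l : 'rV[R]_(size s) => l ord0 i) @^-1` [set x | 0 <= x]))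
    `&` ((fun l : 'rV[R]_(size s) => \sum_i l 0 i) @^-1` [set 1]).
  rewrite eqEsubset; split=> l [l0 l1]; split=> // i; first by move=> _; exact: l0.
  exact: (l0 i I).
apply: closedI.
  apply: closed_bigI => i _; apply: closed_comp; last exact: closed_ge.
  by move=> l _; exact: coord_continuous.
apply: closed_comp; last exact: closed_eq.
by move=> l _; apply: (@cvg_sumr _ _ _ (nbhs l) (nbhs_filter l)) => i; exact: coord_continuous.
Qed.

Lemma nbhs_fst (T : topologicalType) (a b : T) (Q : set T) :
  nbhs a Q -> \forall p \near (a, b), Q p.1.
Proof. by move=> aQ; exact: (@cvg_fst _ _ (nbhs a) (nbhs b) (nbhs_filter b) Q aQ). Qed.

Lemma nbhs_snd (T : topologicalType) (a b : T) (Q : set T) :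
  nbhs b Q -> \forall p \near (a, b), Q p.2.
Proof. by move=> bQ; exact: (@cvg_snd _ _ (nbhs a) (nbhs b) (nbhs_filter a) Q bQ). Qed.

(** Near a diagonal point of P x P the bound is local, from [box_lipschitz]. Near (a, b) with a !=
    b, f is bounded and |x - y| is at least |a - b| / 2. Compactness of P x P makes the constant
    uniform. *)
Lemma C1_lipschitz_compact (f : 'rV[R]_n -> R) (U P : set 'rV[R]_n) :
  open U -> P `<=` U -> compact P ->
  (forall x, U x -> {for x, continuous f}) ->
  (forall j, (forall x, U x -> derivable f x (delta_mx 0 j)) /\
     (forall x, U x -> {for x, continuous ('D_(delta_mx 0 j) f)})) ->
  exists L : R, forall x y, P x -> P y -> `|f x - f y| <= L * `|x - y|.
Proof.
move=> oU PU cP cf df.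
have : \forall L \near +oo, P `*` P `<=` (fun p => `|f p.1 - f p.2| <= L * `|p.1 - p.2|).
  move: (compact_setX cP cP) => /compact_near_coveringP; apply.
  move=> [a b] [/= Pa Pb]; have [ab|ab] := eqVneq a b.
    subst b; have Ua := PU _ Pa.
    have : \forall z \near a, U z /\ forall j, `|'D_(delta_mx 0 j) f z| <= `|'D_(delta_mx 0 j) f a| + 1.
      apply: filterI; first exact: open_nbhs_nbhs.
      apply: (@filter_forall _ _ _ (nbhs a) (nbhs_filter a)) => j; have [_ /(_ a Ua) cj] := df j.
      have /cvgrPdist_le/(_ 1 ltr01) := cj.
      apply: filterS => z zl; rewrite -lerBlDl (le_trans (lerB_dist _ _))// distrC//.
    move=> /nbhs_ballP[r/= r0 rU].
    pose M := \sum_j (`|'D_(delta_mx 0 j) f a| + 1).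
    have M0 : 0 <= M by rewrite sumr_ge0// => j _; rewrite addr_ge0.
    have inball (z : 'rV[R]_n) : (forall i, `|z 0 i - a 0 i| < r / 2) -> ball a r z.
      move=> H; rewrite mx_norm_ball /ball_/= (@le_lt_trans _ _ (r / 2))//; last first.
        by rewrite ltr_pdivrMr// ltr_pMr// ltr1n.
      by apply/mxnormP => [|i]; [rewrite divr_ge0// ltW|rewrite !mxE distrC ltW].
    have BL := @box_lipschitz f a (r / 2) M M0.
    have near_a : \forall z \near a, forall i, `|(z : 'rV[R]_n) 0 i - a 0 i| < r / 2.
      apply: (@filter_forall _ _ _ (nbhs a) (nbhs_filter a)) => i.
      have /cvgrPdist_lt/(_ (r / 2)) : (fun z : 'rV[R]_n => z 0 i) z @[z --> a] --> a 0 i.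
        exact: coord_continuous.
      by move=> /(_ (divr_gt0 r0 (ltr0Sn _ _))); apply: filterS => z; rewrite distrC.
    near=> p L => /=; apply: (@le_trans _ _ (n%:R * M * `|p.1 - p.2|)).
      apply: BL.
      - move=> z /inball /rU [Uz zM] j; split; first by have [+ _] := df j; apply.
        apply: (le_trans (zM j)); rewrite /M (bigD1 j)//= lerDl.
        by apply: sumr_ge0 => l _; apply: addr_ge0.
      - near: p; exact: (nbhs_fst _ (near_a)).
      - near: p; exact: (nbhs_snd _ (near_a)).
    rewrite ler_wpM2r//; near: L; exact: nbhs_pinfty_ge.
  pose e := `|a - b|; have e0 : 0 < e by rewrite normr_gt0 subr_eq0.
  have ca : \forall z \near a, `|f z| <= `|f a| + 1.
    have /cvgrPdist_le/(_ 1 ltr01) := cf a (PU _ Pa).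
    by apply: filterS => z zl; rewrite -lerBlDl (le_trans (lerB_dist _ _))// distrC.
  have cb : \forall z \near b, `|f z| <= `|f b| + 1.
    have /cvgrPdist_le/(_ 1 ltr01) := cf b (PU _ Pb).
    by apply: filterS => z zl; rewrite -lerBlDl (le_trans (lerB_dist _ _))// distrC.
  have e40 : 0 < e / 4 by rewrite divr_gt0.
  have na (c : 'rV[R]_n) : \forall z \near c, `|c - z| <= e / 4.
    by have /cvgrPdist_le/(_ _ e40) := @cvg_id _ (nbhs c).
  pose K := (`|f a| + 1 + (`|f b| + 1)) / (e / 2).
  near=> p L => /=; apply: (@le_trans _ _ (K * `|p.1 - p.2|)).
    have h1 : `|a - p.1| <= e / 4.
      near: p; exact: (nbhs_fst _ (na _)).
    have h2 : `|b - p.2| <= e / 4.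
      near: p; exact: (nbhs_snd _ (na _)).
    have h3 : e / 2 <= `|p.1 - p.2|.
      have : e <= `|a - p.1| + `|p.1 - p.2| + `|p.2 - b|.
        rewrite /e (le_trans (ler_distD p.2 _ _))// lerD2r; exact: ler_distD.
      rewrite [`|p.2 - b|]distrC; lra.
    rewrite (@le_trans _ _ (`|f a| + 1 + (`|f b| + 1)))//.
      rewrite (le_trans (ler_normB _ _))// lerD//.
        near: p; exact: (nbhs_fst _ (ca)).
      near: p; exact: (nbhs_snd _ (cb)).
    by rewrite /K mulrAC ler_pdivlMr ?divr_gt0// ler_wpM2l.
  rewrite ler_wpM2r//; near: L; exact: nbhs_pinfty_ge.
move=> [L0 [_ H]]; exists (L0 + 1) => x y Px Py.
by apply: (H (L0 + 1) _ (x, y)); rewrite ?ltrDl.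
Unshelve. all: by end_near. Qed.

End Lipschitz.

(** * Inradius *)

Section Inradius.
Variables (R : realType) (n : nat).
Variables (x0 : 'rV[R]_n) (vs : seq 'rV[R]_n).
Local Notation k := (size vs).
Local Notation E := (rowsmx k (elist (x0 :: vs))).
Hypothesis free : forall u : 'rV_k, u *m E = 0 -> u = 0.

Lemma row_coord_inj : injective (fun u : 'rV_k => x0 + u *m E).
Proof.
move=> u v /addrI /eqP; rewrite -subr_eq0 -mulmxBl => /eqP /free /eqP.
by rewrite subr_eq0 => /eqP.
Qed.

Lemma gram_unit : E *m E^T \in unitmx.
Proof. by rewrite unitmxE unitfE gt_eqF// gram_det_gt0. Qed.

Definition ball_radii : set R := [set r : R | 0 <= r /\ exists c, aff (x0 :: vs) c /\
  forall y, aff (x0 :: vs) y -> enorm (y - c) <= r -> Defs.conv (x0 :: vs) y].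

Lemma inradE : inrad (x0 :: vs) = sup ball_radii. Proof. by []. Qed.

Lemma conv_coord (u : 'rV_k) : Defs.conv (x0 :: vs) (x0 + u *m E) ->
  (forall i, 0 <= u 0 i) /\ \sum_i u 0 i <= 1.
Proof. by move=> /conv_row [v [v0 [v1 /row_coord_inj ->]]]. Qed.

(* The points c +- r a E / |a E| of the inscribed ball have barycentric
   coordinates in [0, 1]. *)
Lemma ball_coord r (a : 'rV_k) i : ball_radii r ->
  (r * a 0 i) ^+ 2 <= edot (a *m E) (a *m E).
Proof.
move=> [r0 [c [/aff_row [v ->] ball]]].
have [->|a0] := eqVneq a 0; first by rewrite mxE mulr0 expr0n mul0mx edotE mul0mx mxE.
have e0 : 0 < enorm (a *m E).
  rewrite lt_neqAle enorm_ge0 andbT eq_sym; apply: contra a0 => /eqP e0.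
  apply/eqP/free/dotmx_eq0; rewrite /dotmx -edotE -enorm_sqr e0 expr0n//.
pose rho := r / enorm (a *m E).
have inb (sg : R) : `|sg| = 1 -> forall i, 0 <= (v + (sg * rho) *: a) 0 i <= 1.
  move=> sg1.
  have /conv_coord [u0 u1] : Defs.conv (x0 :: vs) (x0 + (v + (sg * rho) *: a) *m E).
    apply: ball; first by apply/aff_row; eexists.
    rewrite mulmxDl opprD addrA [x0 + _]addrC addrK [v *m E + _]addrC addrK.
    rewrite -scalemxAl /enorm.
    have -> : edot ((sg * rho) *: (a *m E)) ((sg * rho) *: (a *m E)) =
        (sg * rho) ^+ 2 * edot (a *m E) (a *m E).
      by rewrite /edot mulr_sumr; apply: eq_bigr => j _; rewrite !mxE; ring.
    rewrite sqrtrM ?sqr_ge0// sqrtr_sqr -/(enorm _) normrM sg1 mul1r.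
    rewrite ger0_norm ?divr_ge0 ?enorm_ge0//.
    by rewrite /rho divfK ?gt_eqF.
  move=> j; rewrite u0/= (le_trans _ u1)// (bigD1 j)//= lerDl sumr_ge0//.
have := inb 1 (normr1 _) i; have := inb (-1) (normrN1 _) i.
rewrite !mxE mulN1r mul1r mulNr => /andP[h1 h2] /andP[h3 h4].
rewrite -enorm_sqr -[X in _ <= X]real_normK ?num_real// -[X in X <= _]real_normK ?num_real//.
apply: lerXn2r; rewrite ?nnegrE//.
rewrite [X in _ <= X]gtr0_norm//.
have -> : r * a 0 i = (rho * a 0 i) * enorm (a *m E).
  by rewrite /rho; field; rewrite gt_eqF.
rewrite normrM (gtr0_norm e0); apply: ler_piMl; first exact: ltW.
rewrite ler_norml.
by move: (rho * a 0 i) h1 h2 h3 h4 => w; lra.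
Qed.

(** Averaging [ball_coord] over i bounds the Gram form below by a multiple of the standard form, and
    [det_mono] turns this into a bound on determinants. *)
Lemma radius_pow_le r : ball_radii r ->
  r ^+ k <= k%:R ^+ k * Num.sqrt (\det (E *m E^T)).
Proof.
move=> br; have r0 : 0 <= r by case: br.
have [k0|kn0] := eqVneq k 0%N.
  have -> : \det (E *m E^T) = 1 by move: (E *m E^T); rewrite k0 => M; rewrite det_mx00.
  by rewrite k0 !expr0 sqrtr1 mulr1.
have kR : 0 < k%:R :> R by rewrite ltr0n lt0n.
have [rz|rn0] := eqVneq r 0.
  by rewrite rz expr0n (negbTE kn0) mulr_ge0// ?exprn_ge0// sqrtr_ge0.
have rp : 0 < r by rewrite lt_neqAle eq_sym rn0.
(* The average would allow r^2 / k; the smaller (r / k)^2 is a square, convenient for the final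
   root. *)
pose b := (r / k%:R) ^+ 2; have b0 : 0 < b by rewrite exprn_gt0// divr_gt0.
have sG : (E *m E^T)^T = E *m E^T by rewrite trmx_mul trmxK.
have sB : (b%:M : 'M[R]_k)^T = b%:M by rewrite tr_scalar_mx.
have qq (u : 'rV[R]_k) : u != 0 -> 0 < qform b%:M u <= qform (E *m E^T) u.
  move=> u0; have -> : qform b%:M u = b * dotmx u u.
    by rewrite /qform mul_mx_scalar -scalemxAl mxE.
  have du : 0 < dotmx u u.
    by rewrite lt_neqAle dotmx_ge0 andbT eq_sym; apply: contra u0 => /eqP/dotmx_eq0 ->.
  rewrite mulr_gt0//= qform_gram [dotmx u u]dotmxE /dotmx -edotE.
  have : b * \sum_i u 0 i * u 0 i <= \sum_(i < k) (edot (u *m E) (u *m E) / k%:R).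
    rewrite mulr_sumr; apply: ler_sum => i _.
    rewrite ler_pdivlMr// (le_trans _ (ball_coord u i br))//.
    have -> : b * (u 0 i * u 0 i) * k%:R = (r * u 0 i) ^+ 2 * k%:R^-1.
      by rewrite /b; field; rewrite gt_eqF.
    by apply: ler_piMr; [exact: sqr_ge0|rewrite invf_le1// ler1n lt0n].
  by rewrite sumr_const card_ord -[_ *+ k]mulr_natr divfK ?gt_eqF.
have /andP[_ le] := det_mono sG sB qq.
rewrite det_scalar in le.
have : (r / k%:R) ^+ k <= Num.sqrt (\det (E *m E^T)).
  rewrite -[leLHS]ger0_norm ?exprn_ge0 ?divr_ge0// -sqrtr_sqr ler_sqrt.
    by rewrite exprAC.
  exact: gram_det_ge0.
by rewrite expr_div_n ler_pdivrMr ?exprn_gt0// mulrC.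
Qed.

(** A ball about the barycenter. Positivity matters because x / 0 = 0: the final bound divides by
    the inradius. *)
Lemma pos_radius : exists2 r, 0 < r & ball_radii r.
Proof.
pose v : 'rV[R]_k := const_mx (k.+1%:R^-1).
(* A right inverse of E, recovering edge coordinates from a vector. *)
pose T : 'M[R]_(n, k) := E^T *m invmx (E *m E^T).
pose M : R := \sum_i \sum_j `|T i j|.
have Mb i j : `|T i j| <= M.
  rewrite /M (bigD1 i)//= (bigD1 j)//= -addrA lerDl addr_ge0 ?sumr_ge0// => l _.
  by rewrite sumr_ge0.
have M0 : 0 <= M by do 2!apply: sumr_ge0 => ? _.
pose D := n%:R * M + 1; have D0 : 0 < D by rewrite ltr_wpDl// mulr_ge0.
have k1 : 0 < k.+1%:R :> R by rewrite ltr0n.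
(* Moving the k coordinates 1 / (k+1) of the barycenter by at most d keeps them nonnegative and
   their sum at most 1 - d. *)
pose d : R := (k.+1%:R)^-1 ^+ 2; have d0 : 0 < d by rewrite exprn_gt0// invr_gt0.
exists (d / D); first by rewrite divr_gt0.
split; first by rewrite divr_ge0// ltW.
exists (x0 + v *m E); split; first by apply/aff_row; eexists.
move=> y /aff_row [u ->].
rewrite opprD addrACA subrr add0r -mulmxBl => le.
have ub i : `|(u - v) 0 i| <= d.
  have -> : u - v = ((u - v) *m E) *m T by rewrite mulmxA -[_ *m E *m _]mulmxA mulmxK// gram_unit.
  rewrite (le_trans (@mulmx_entry_bound _ _ _ _ _ (d / D) M _ _ _ _))//.
  - by rewrite divr_ge0// ltW.
  - by move=> j; apply: le_trans le; exact: abs_coord_le_enorm.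
  - rewrite mulrCA -[leRHS]mulr1 -mulrA ler_pM2l// mulrC ler_pdivrMr// mul1r.
    by rewrite /D lerDl.
have dk : d <= k.+1%:R^-1.
  by rewrite /d expr2; apply: ler_piMr; [rewrite invr_ge0 ltW|rewrite invf_le1// ler1n].
apply/conv_row; exists u; split; [|split=> //].
  move=> i; have := ub i; rewrite ler_norml !mxE => /andP[h _].
  by move: dk h; move: (k.+1%:R^-1) => w; lra.
apply: (@le_trans _ _ (\sum_(i < k) (k.+1%:R^-1 + d))).
  apply: ler_sum => i _; have := ub i; rewrite ler_norml !mxE => /andP[_].
  by rewrite lerBlDl.
rewrite sumr_const card_ord -[_ *+ k]mulr_natl /d.
have -> : k%:R = k.+1%:R - 1 :> R by rewrite -natr1 addrK.
move: (k.+1%:R : R) k1 => w w0; rewrite -subr_ge0.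
have -> : 1 - (w - 1) * (w^-1 + w^-1 ^+ 2) = w^-1 ^+ 2 by field; rewrite gt_eqF.
by rewrite exprn_ge0// invr_ge0 ltW.
Qed.

(** [sup] needs an upper bound of the radii themselves, hence the k-th root [M]. For k = 0 every r
    >= 0 is a radius and there is none. *)
Lemma inrad_gt0 : (0 < k)%N -> 0 < inrad (x0 :: vs) /\
  inrad (x0 :: vs) ^+ k <= k%:R ^+ k * Num.sqrt (\det (E *m E^T)).
Proof.
move=> k0; set D := _ * _.
have D0 : 0 <= D by rewrite mulr_ge0 ?exprn_ge0// sqrtr_ge0.
pose M := D `^ (k%:R^-1).
have Mk : M ^+ k = D.
  by rewrite -powR_mulrn ?powR_ge0// /M -powRrM mulVf ?powRr1// pnatr_eq0 -lt0n.
have ubM : ubound ball_radii M.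
  move=> r br; rewrite leNgt; apply/negP => Mr.
  have : M ^+ k < r ^+ k by rewrite ltrXn2r ?powR_ge0// -lt0n.
  by rewrite Mk ltNge radius_pow_le.
have [r0 r00 br0] := pos_radius.
have le_r0 : r0 <= sup ball_radii by apply: ub_le_sup => //; exists M.
rewrite inradE; split; first exact: lt_le_trans le_r0.
rewrite -Mk; apply: lerXn2r; rewrite ?nnegrE ?powR_ge0//.
  exact: le_trans (ltW r00) le_r0.
by apply: ge_sup => //; exists r0.
Qed.

End Inradius.

(** * The Hodge star at a point *)

Section Forms.
Variables (R : realType) (n : nat).

Definition minor q (I : {set 'I_n}) (M : 'M[R]_(q, n)) : R :=
  \det (\matrix_(a < q, b < q) nth 0 [seq M b i | i <- enum I] a).

Lemma formvalE q (vs : seq 'rV[R]_n) (w : kform R n) (x : 'rV[R]_n) : size vs = q ->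
  formval w x vs = \sum_(I : {set 'I_n} | #|I| == q) w I x * minor I (rowsmx q vs).
Proof.
move=> <-; apply: eq_bigr => I _; congr (_ * \det _).
apply/matrixP => a b; rewrite !mxE; congr nth.
by apply: eq_map => i; rewrite mxE.
Qed.

Definition set_elt q (I : {set 'I_n}) (H : #|I| = q) (a : 'I_q) : 'I_n :=
  enum_val (cast_ord (esym H) a).

Lemma set_elt_inj q (I : {set 'I_n}) (H : #|I| = q) : injective (set_elt H).
Proof. by move=> a b /enum_val_inj /cast_ord_inj. Qed.

Lemma set_elt_in q (I : {set 'I_n}) (H : #|I| = q) a : set_elt H a \in I.
Proof. exact: enum_valP. Qed.

Lemma sum_set_elt q (I : {set 'I_n}) (H : #|I| = q) (f : 'I_n -> nat) :
  (\sum_(i in I) f i = \sum_a f (set_elt H a))%N.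
Proof.
case: q / H; rewrite big_enum_val; apply: eq_bigr => a _.
by rewrite /set_elt; congr (f (enum_val _)); apply/val_inj.
Qed.

Lemma set_elt_mono q (I : {set 'I_n}) (H : #|I| = q) (a b : 'I_q) :
  (a < b)%N -> (set_elt H a < set_elt H b)%N.
Proof.
move=> ab; pose x0 := set_elt H a.
have E c : val (set_elt H c) = nth 0%N [seq val i | i <- enum I] c.
  rewrite (nth_map x0); last by rewrite -cardE H.
  by rewrite [in LHS]/set_elt (enum_val_nth x0).
rewrite [X in (X < _)%N]E [X in (_ < X)%N]E.
have st : sorted ltn [seq val i | i <- enum I].
  apply: (@subseq_sorted _ _ ltn_trans _ (iota 0 n)); last exact: iota_ltn_sorted.
  by rewrite -val_enum_ord map_subseq// enumT; exact: filter_subseq.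
by apply: (sorted_ltn_nth ltn_trans 0%N st); rewrite // inE size_map -cardE H.
Qed.

Lemma minor_colsub q (I : {set 'I_n}) (H : #|I| = q) (M : 'M[R]_(q, n)) :
  minor I M = \det (colsub (set_elt H) M).
Proof.
rewrite -det_tr; congr (\det _); apply/matrixP => a b; rewrite !mxE.
rewrite (nth_map (set_elt H a)) -?cardE ?H//.
by rewrite [in RHS]/set_elt (enum_val_nth (set_elt H a)).
Qed.

Lemma minor_le q (I : {set 'I_n}) (H : #|I| = q) (M : 'M[R]_(q, n)) :
  `|minor I M| <= Num.sqrt (\det (M *m M^T)).
Proof.
rewrite (minor_colsub H) -sqrtr_sqr ler_sqrt ?gram_det_ge0//.
exact: minor_le_gram (@set_elt_inj _ _ _).
Qed.

(** Each minor is at most the root of the Gram determinant, so the error is relative to the volume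
    spanned by vs; counting all index sets is a crude bound for those of size q. *)
Lemma formval_lip q (vs : seq 'rV[R]_n) (w : kform R n) (x y : 'rV[R]_n) (e : R) :
  size vs = q -> 0 <= e ->
  (forall I : {set 'I_n}, #|I| = q -> `|w I x - w I y| <= e) ->
  `|formval w x vs - formval w y vs| <=
    #|{set 'I_n}|%:R * e * Num.sqrt (\det (rowsmx q vs *m (rowsmx q vs)^T)).
Proof.
move=> sq e0 we; rewrite !(formvalE _ _ sq) -sumrB.
apply: (le_trans (ler_norm_sum _ _ _)).
rewrite -mulrA [leRHS]mulr_natl -sumr_const [leRHS](bigID (fun I : {set 'I_n} => #|I| == q))/=.
rewrite -[leLHS]addr0 lerD//; last first.
  by rewrite sumr_ge0// => I _; rewrite mulr_ge0// sqrtr_ge0.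
apply: ler_sum => I /eqP Iq; rewrite -mulrBl normrM ler_pM//.
  exact: we.
exact: minor_le.
Qed.

End Forms.

(** * The Hodge star on orthogonal complementary families *)

Section HodgeIdentity.
Variables (R : realType) (k m : nat).
Local Notation n := (k + m)%N.

Lemma card_setC_km (I : {set 'I_n}) : (#|finset.setC I| == m) = (#|I| == k).
Proof. by have := cardsC I; rewrite card_ord; lia. Qed.

Lemma inv_countE (I : {set 'I_n}) (H : #|I| = k) (H' : #|finset.setC I| = m) :
  inv_count I = (\sum_a \sum_b (set_elt H' b < set_elt H a))%N.
Proof.
rewrite /inv_count (sum_set_elt H); apply: eq_bigr => a _.
rewrite -(sum_set_elt H' (fun j => (j < set_elt H a)%N : nat)).
rewrite -sum1_card big_mkcond [RHS]big_mkcond; apply: eq_bigr => j _.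
(* The set in [inv_count] is a classical one, so its cardinal is taken through [in_set]. *)
have -> : (j \in in_set [set j0 : 'I_n | (j0 \notin I) && (j0 < set_elt H a)%N]) =
  (j \notin I) && (j < set_elt H a)%N by rewrite /mkset /in_mem /mem /= /in_set asboolb.
by rewrite finset.in_setC; case: (j \in I) => //=; case: ltnP.
Qed.

Lemma hodge_minor (I : {set 'I_n}) (E : 'M[R]_(k, n)) (F : 'M[R]_(m, n)) :
  #|I| = k -> E *m F^T = 0 ->
  \det (col_mx E F) * ((-1) ^+ inv_count I * minor (finset.setC I) F) =
  minor I E * \det (F *m F^T).
Proof.
move=> H EF; have H' : #|finset.setC I| = m by apply/eqP; rewrite card_setC_km H.
have gg' i j : set_elt H i != set_elt H' j.
  by apply/eqP => e; have := set_elt_in H' j; rewrite -e finset.in_setC set_elt_in.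
have gI := @set_elt_inj _ _ _ H; have gI' := @set_elt_inj _ _ _ H'.
rewrite (inv_countE H H') (minor_colsub H) (minor_colsub H').
rewrite -(@complementary_minor R k m _ _ gI gI' gg' _ _ EF).
by rewrite (@det_selmx R k m _ _ gI gI' gg' (@set_elt_mono _ _ _ H) (@set_elt_mono _ _ _ H')).
Qed.

(** Pairing I with its complement reduces this to [hodge_minor] term by term. As |\det (E; F)| is
    the product of the two roots, one factor \sqrt(\det (F F^T)) cancels. *)
Lemma hodge_formval (w : kform R n) (c : 'rV[R]_n) (es fs : seq 'rV[R]_n)
    (E := rowsmx k es) (F := rowsmx m fs) :
  size es = k -> size fs = m -> E *m F^T = 0 ->
  Num.sg (\det (col_mx E F)) * Num.sqrt (\det (E *m E^T)) * formval (hodge w) c fs =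
  Num.sqrt (\det (F *m F^T)) * formval w c es.
Proof.
move=> ek fm EF; rewrite (formvalE _ _ ek) (formvalE _ _ fm) !mulr_sumr.
rewrite (reindex_inj (@finset.setC_inj _))/=.
under eq_bigl do rewrite card_setC_km.
apply: eq_bigr => I /eqP Ik; rewrite /hodge finset.setCK.
have := hodge_minor Ik EF; rewrite -/E -/F.
have := det_col_mx_orth EF.
have GE := gram_det_ge0 E; have GF := gram_det_ge0 F.
have := sqr_sqrtr GE; have := sqr_sqrtr GF.
move: (sqrtr_ge0 (\det (E *m E^T))) (sqrtr_ge0 (\det (F *m F^T))).
move: (Num.sqrt (\det (E *m E^T))) (Num.sqrt (\det (F *m F^T))) => a b a0 b0.
move=> <- <-; move: (\det (col_mx E F)) => D.
move: ((-1) ^+ _) (w I c) (minor _ _) (minor _ _) => s wI Y X D2 DX.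
have Dab : `|D| = a * b.
  apply/eqP; rewrite -(@eqrXn2 _ 2)// ?mulr_ge0// real_normK ?num_real// D2 exprMn//.
(* In the degenerate case the sign is 0, so both sides vanish. *)
have [bz|b_neq0] := eqVneq b 0.
  have -> : D = 0 by apply/eqP; rewrite -normr_eq0 Dab bz mulr0.
  by rewrite sgr0 bz !mul0r.
apply: (mulfI b_neq0).
transitivity (wI * ((a * b * Num.sg D) * (s * X))); first by ring.
rewrite -Dab mulrC [`|D| * _]mulrC -numEsg DX; ring.
Qed.

End HodgeIdentity.

(** * Simplices around a common face *)

Section BarycentricallyFree.
Variables (R : realType) (n : nat).
Local Notation point := 'rV[R]_n.

(** Affine independence in a form without distinguished vertex, hence inherited by faces listed in
    any order. *)
Definition bary_free (s : seq point) := forall l l' : 'I_(size s) -> R,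
  \sum_i l i = 1 -> \sum_i l' i = 1 ->
  \sum_i l i *: nth 0 s i = \sum_i l' i *: nth 0 s i -> forall i, l i = l' i.

Lemma bary_free_uniq s : bary_free s -> uniq s.
Proof.
move=> fs; apply/(uniqP 0) => i j; rewrite !inE => si sj eq.
pose I := Ordinal si; pose J := Ordinal sj.
pose d (a : 'I_(size s)) b : R := (b == a)%:R.
have d1 a : \sum_b d a b = 1.
  by rewrite (bigD1 a)//= /d eqxx big1 ?addr0// => b /negbTE ->.
have ds a : \sum_b d a b *: nth 0 s b = nth 0 s a.
  rewrite (bigD1 a)//= /d eqxx scale1r big1 ?addr0// => b /negbTE ->.
  by rewrite scale0r.
have := fs (d I) (d J) (d1 _) (d1 _); rewrite !ds => /(_ eq I).
rewrite /d eqxx; case: eqVneq => [[]//|_ /eqP].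
by rewrite oner_eq0.
Qed.

Lemma bary_free_sub s t : bary_free s -> uniq t -> {subset t <= s} -> bary_free t.
Proof.
move=> fs ut ts l l' l1 l1' ll i; have us := bary_free_uniq fs.
have [m [m1 m2 _ m3]] := reindex_bary l ts.
have [m' [m1' m2' _ m3']] := reindex_bary l' ts.
have it : (index (nth 0%R t i) s < size s)%N by rewrite index_mem ts// mem_nth.
have ni : nth 0 s (Ordinal it) = nth 0 t i by rewrite nth_index// ts// mem_nth.
rewrite -(m3 ut us _ _ ni) -(m3' ut us _ _ ni); apply: fs.
- by rewrite m1.
- by rewrite m1'.
- by rewrite m2 m2'.
Qed.

Lemma bary_free_row x0 vs : bary_free (x0 :: vs) ->
  forall u : 'rV_(size vs), u *m rowsmx (size vs) (elist (x0 :: vs)) = 0 -> u = 0.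
Proof.
move=> fs u uE; apply/rowP => i.
have := fs (bary_of_row u) (bary_of_row 0) (bary_of_row_sum _) (bary_of_row_sum _).
rewrite !bary_of_rowE uE mul0mx => /(_ erefl (lift ord0 i)).
by rewrite /bary_of_row liftK.
Qed.

Lemma row_bary_free x0 vs :
  (forall u : 'rV_(size vs), u *m rowsmx (size vs) (elist (x0 :: vs)) = 0 -> u = 0) ->
  bary_free (x0 :: vs).
Proof.
move=> free l l' l1 l1'; rewrite (bary_row _ l1) (bary_row _ l1').
move=> /(row_coord_inj free) /rowP ll.
have lift_eq i : l (lift ord0 i) = l' (lift ord0 i) by have := ll i; rewrite !mxE.
move=> i; case: (unliftP ord0 i) => [j ->|->]; first exact: lift_eq.
have : \sum_i l i = \sum_i l' i by rewrite l1 l1'.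
by rewrite !big_ord_recl (eq_bigr _ (fun i _ => lift_eq i)) => /addIr.
Qed.

Lemma size_nsimplex_free s : size s = n.+1 -> sdet (elist s) != 0 -> bary_free s.
Proof.
case: s => // x0 vs [svs]; rewrite sdetE => dE; apply: row_bary_free.
move: (elist _) dE => L dE.
have uL : rowsmx n L \in unitmx by rewrite unitmxE unitfE.
have free (u : 'rV_n) : u *m rowsmx n L = 0 -> u = 0.
  by move=> /(congr1 (mulmx^~ (invmx (rowsmx n L)))); rewrite mulmxK// mul0mx.
have cast p : p = n -> forall u : 'rV_p, u *m rowsmx p L = 0 -> u = 0.
  by move=> e; subst p; exact: free.
exact: cast.
Qed.

(* Otherwise the barycentric coordinate of y at a vertex of s outside t would
   be both positive and 0. *)
Lemma relint_face s t y : bary_free s -> {subset t <= s} ->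
  relint s y -> Defs.conv t y -> {subset s <= t}.
Proof.
move=> fs ts [l [l0 [l1 ly]]] [r [r0 [r1 ry]]] x xs.
have [m [m1 m2 m3 _]] := reindex_bary r ts.
apply/negPn/negP => xt; have ix : (index x s < size s)%N by rewrite index_mem.
have := l0 (Ordinal ix); have -> : l (Ordinal ix) = m (Ordinal ix).
  by apply: fs; rewrite ?m1// m2 -ry.
by rewrite m3 ?ltxx// nth_index.
Qed.

Lemma enorm_le_mesh (K : seq (seq point)) s x y : s \in K -> x \in s -> y \in s ->
  enorm (x - y) <= mesh K.
Proof.
move=> sK xs ys; rewrite /mesh.
apply: (@bigmax_sup_seq _ _ _ _ 0 s xpredT) => //.
apply: (@bigmax_sup_seq _ _ _ _ 0 x xpredT) => //.
exact: (@le_bigmax_seq _ _ _ _ 0 y xpredT (fun y => enorm (x - y))).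
Qed.

Lemma mesh_ge0 (K : seq (seq point)) : 0 <= mesh K.
Proof.
rewrite /mesh; elim/big_ind: _ => //; last first.
- by move=> s _; elim/big_ind: _ => // [a b a0 b0|x _]; rewrite ?le_max ?a0//;
    elim/big_ind: _ => // [a b a0 b0|y _]; rewrite ?le_max ?a0// enorm_ge0.
- by move=> a b a0 b0; rewrite le_max a0.
Qed.

Lemma coord_diff_conv (s : seq point) (h : R) y z i :
  (forall a b, a \in s -> b \in s -> `|(a - b) 0 i| <= h) ->
  Defs.conv s y -> Defs.conv s z -> `|(y - z) 0 i| <= h.
Proof.
move=> H [l [l0 [l1 ->]]] [r [r0 [r1 ->]]].
(* The difference is the average of the vertex differences with weights l_a r_b. *)
have -> : \sum_i l i *: nth 0 s i - \sum_i r i *: nth 0 s i =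
  \sum_a \sum_b (l a * r b) *: (nth 0 s a - nth 0 s b).
  transitivity (\sum_a \sum_b (l a * r b) *: nth 0 s a -
                \sum_a \sum_b (l a * r b) *: nth 0 s b).
    congr (_ - _).
      by apply: eq_bigr => a _; rewrite -scaler_suml -mulr_sumr r1 mulr1.
    rewrite exchange_big/=.
    by apply: eq_bigr => a _; rewrite -scaler_suml -mulr_suml l1 mul1r.
  rewrite -sumrB; apply: eq_bigr => a _; rewrite -sumrB.
  by apply: eq_bigr => b _; rewrite scalerBr.
rewrite summxE (le_trans (ler_norm_sum _ _ _))//.
have -> : h = \sum_a \sum_b (l a * r b) * h.
  under eq_bigr do rewrite -mulr_suml -mulr_sumr r1 mulr1.
  by rewrite -mulr_suml l1 mul1r.
apply: ler_sum => a _; rewrite summxE (le_trans (ler_norm_sum _ _ _))//.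
apply: ler_sum => b _; rewrite mxE normrM ger0_norm ?mulr_ge0//.
by rewrite ler_wpM2l ?mulr_ge0// H// mem_nth.
Qed.

Lemma coord_diff_mesh (K : seq (seq point)) s y z i : s \in K ->
  Defs.conv s y -> Defs.conv s z -> `|(y - z) 0 i| <= mesh K.
Proof.
move=> sK; apply: coord_diff_conv => a b sa sb.
exact: le_trans (abs_coord_le_enorm _ _) (enorm_le_mesh sK sa sb).
Qed.

Lemma open_simplex_relint (x0 : point) (vs : seq point) (y : point) : size vs = n ->
  open_simplex x0 (rowsmx n (elist (x0 :: vs))) y -> relint (x0 :: vs) y.
Proof.
move=> svs [u [u0 [u1 ->]]].
have H p (e : size vs = p) (v : 'rV[R]_p) : (forall i, 0 < v 0 i) ->
    \sum_i v 0 i < 1 -> relint (x0 :: vs) (x0 + v *m rowsmx p (elist (x0 :: vs))).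
  by case: p / e v => v; exact: relint_row.
exact: H.
Qed.

Lemma relint_conv (s : seq point) y : relint s y -> Defs.conv s y.
Proof. by move=> [l [l0 [l1 ->]]]; exists l; split=> // i; rewrite ltW. Qed.

(** All these simplices contain the first vertex x of t, so they lie in the box of radius [mesh K]
    about x. A point interior to two of them lies in the hull of their common vertices, so by
    [relint_face] all vertices are common and the simplices coincide. *)
Lemma star_det_sum (P : set point) (K : seq (seq point)) t : triangulates K P ->
  t != [::] ->
  \sum_(s <- K | all (fun x => x \in s) t) sdet (elist s) <=
    (2 * (n.*2.+1)%:R * mesh K) ^+ n.
Proof.
move=> [Ks [uK pK] iK _]; case: t => // x t _.
set S := [seq s <- K | all (fun y => y \in s) (x :: t)].
have SK s : s \in S -> s \in K by rewrite mem_filter => /andP[].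
have Sfree s : s \in K -> bary_free s.
  move=> /Ks[[ss _] ds]; apply: size_nsimplex_free => //; by rewrite gt_eqF.
have Sn (j : 'I_(size S)) : nth [::] S j \in K by apply: SK; rewrite mem_nth.
rewrite -big_filter -/S (big_nth [::]) big_mkord.
have sh s : s \in K -> s = head 0 s :: behead s.
  by move=> /Ks[[ss _] _]; case: s ss.
have sb s : s \in K -> size (behead s) = n.
  by move=> /Ks[[ss _] _]; rewrite size_behead ss.
have opr (j : 'I_(size S)) (y : point) : open_simplex (head 0 (nth [::] S j))
    (rowsmx n (elist (nth [::] S j))) y -> relint (nth [::] S j) y.
  move=> oy; rewrite [nth _ _ _]sh//; apply: open_simplex_relint; first exact: sb.
  by rewrite -sh.
have := @simplex_packing R n 'I_(size S) (fun j => head 0 (nth [::] S j))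
  (fun j => rowsmx n (elist (nth [::] S j))) x (mesh K) (mesh_ge0 K).
move=> pack; apply: le_trans (pack _ _ _).
- apply: ler_sum => j _; rewrite sdetE; exact: ler_norm.
- by move=> j; have [_ ds] := Ks _ (Sn j); rewrite -sdetE gt_eqF.
- move=> j y /opr/relint_conv cy i; apply: (coord_diff_mesh _ (Sn j)) => //.
  apply: mem_conv; have : nth [::] S j \in S by rewrite mem_nth.
  by rewrite mem_filter/= => /andP[/andP[]].
- move=> j j' y /opr ry /opr ry'.
  have cyy : Defs.conv [seq x <- nth [::] S j | x \in nth [::] S j'] y.
    by rewrite -(iK _ _ (Sn j) (Sn j')); split; exact: relint_conv.
  have sub : {subset nth [::] S j <= nth [::] S j'}.
    move=> z zs; have := relint_face (Sfree _ (Sn j)) _ ry cyy.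
    move=> /(_ _ z zs); rewrite mem_filter => H.
    by have /andP[] : (z \in nth [::] S j') && (z \in nth [::] S j)
      by apply: H => w; rewrite mem_filter => /andP[].
  have [[s1 _] _] := Ks _ (Sn j); have [[s2 _] _] := Ks _ (Sn j').
  have [_ eqi] := uniq_min_size (bary_free_uniq (Sfree _ (Sn j))) sub
    (eq_leq (etrans s2 (esym s1))).
  have ss : nth [::] S j = nth [::] S j'.
    apply: pK => //; apply: uniq_perm => //; exact: bary_free_uniq (Sfree _ (Sn _)).
  have uS : uniq S by exact: filter_uniq.
  apply/val_inj/eqP; rewrite -(nth_uniq [::] (ltn_ord j) (ltn_ord j') uS).
  exact/eqP.
Qed.

End BarycentricallyFree.

(** * Dual cells *)

Section DualPieces.
Variables (R : realType) (n : nat).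
Local Notation point := 'rV[R]_n.

Lemma sum_zip_rowsmx (t : seq R) (L : seq point) : size t = size L ->
  \sum_(p <- zip t L) p.1 *: p.2 = (\row_i nth 0 t i) *m rowsmx (size L) L.
Proof.
move=> tL; rewrite mulmx_sum_row (big_nth (0, 0)) size_zip tL minnn big_mkord.
by apply: eq_bigr => i _; rewrite nth_zip//= mxE rowK.
Qed.

Lemma sint_near x0 (vs : seq point) (w : kform R n) (c : point) (e : R)
    (xs := x0 :: vs) (q := size vs) :
  (forall y, Defs.conv xs y ->
     `|formval w y (elist xs) - formval w c (elist xs)| <= e) ->
  `|sint w xs - formval w c (elist xs) / q`!%:R| <= e / q`!%:R.
Proof.
move=> near_c; rewrite /sint size_elist -/q.
set f := fun t => _; set v := formval w c _.
have : (v - e) * (1 ^+ q / q`!%:R) <= simplex_int q f 1 <= (v + e) * (1 ^+ q / q`!%:R).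
  apply: simplex_int_bounds => // t st t0 t1.
  suff /near_c : Defs.conv xs (x0 + \sum_(p <- zip t (elist xs)) p.1 *: p.2).
    by rewrite -/v ler_norml /f /= => /andP[h1 h2]; apply/andP; split; lra.
  apply/conv_row; rewrite sum_zip_rowsmx ?size_elist//.
  exists (\row_i nth 0 t i); split; last split=> //.
    by move=> i; rewrite mxE; apply: (allP t0); rewrite mem_nth// st.
  apply: le_trans t1; rewrite (big_nth 0) big_mkord st.
  by under eq_bigr do rewrite mxE.
rewrite expr1n mul1r mulrBl mulrDl ler_norml => /andP[h1 h2].
by apply/andP; split; lra.
Qed.

(** M = W A with entries of W in [-1, 1], and the expansion of \det W has n! terms. *)
Lemma det_rows_bound (M A : 'M[R]_n) :
  (forall i, exists w : 'rV[R]_n, (forall j, `|w 0 j| <= 1) /\ row i M = w *m A) ->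
  `|\det M| <= n`!%:R * `|\det A|.
Proof.
move=> H; pose w i := sval (cid (H i)).
have wP i : (forall j, `|w i 0 j| <= 1) /\ row i M = w i *m A := svalP (cid (H i)).
have -> : M = (\matrix_i w i) *m A.
  by apply/row_matrixP => i; rewrite row_mul rowK (wP i).2.
rewrite det_mulmx normrM ler_wpM2r// (le_trans (ler_norm_sum _ _ _))//.
rewrite -perm.card_Sn -sumr_const; apply: ler_sum => s _.
rewrite normrM normr_sign mul1r normr_prod.
by apply: prodr_ile1 => i _; rewrite normr_ge0/= mxE (wP i).1.
Qed.

Lemma conv_diff (s : seq point) y z : size s = n.+1 ->
  Defs.conv s y -> Defs.conv s z -> exists w : 'rV[R]_n,
    (forall j, `|w 0 j| <= 1) /\ y - z = w *m rowsmx n (elist s).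
Proof.
case: s => // x0 vs [svs] cy cz.
have H p (e : size vs = p) : exists w : 'rV[R]_p,
    (forall j, `|w 0 j| <= 1) /\ y - z = w *m rowsmx p (elist (x0 :: vs)).
  subst p; move/conv_row: cy => [u [u0 [u1 ->]]]; move/conv_row: cz => [v [v0 [v1 ->]]].
  have le1 (x : 'rV[R]_(size vs)) : (forall i, 0 <= x 0 i) -> \sum_i x 0 i <= 1 ->
      forall i, x 0 i <= 1.
    by move=> x0' x1 i; apply: le_trans x1; rewrite (bigD1 i)//= lerDl sumr_ge0.
  exists (u - v); split; last by rewrite mulmxBl opprD addrACA subrr add0r.
  move=> j; rewrite !mxE; have := u0 j; have := v0 j.
  have := le1 _ u0 u1 j; have := le1 _ v0 v1 j.
  by rewrite ler_norml => *; apply/andP; split; lra.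
exact: H.
Qed.

Lemma wc_circumcenter (K : seq (seq point)) s t : well_centered K -> s \in K ->
  bary_free s -> uniq t -> {subset t <= s} -> t != [::] ->
  is_circumcenter t (circumcenter t) /\ Defs.conv s (circumcenter t).
Proof.
move=> wc sK fs ut ts t0; split.
  case: t ut ts t0 => // t0 w ut ts _; apply: ex_circumcenter.
  exact: bary_free_row (bary_free_sub fs ut ts).
(* t rearranged in the order of s, as [well_centered] requires. *)
pose t' := [seq x <- s | x \in t].
have tt' : perm_eq t t'.
  apply: uniq_perm => //; first exact: filter_uniq (bary_free_uniq fs).
  move=> x; rewrite mem_filter; case xt: (x \in t) => //=.
  by rewrite ts.
rewrite (perm_circumcenter tt'); apply: (@conv_conv _ _ _ t').
  by move=> x; rewrite mem_filter => /andP[_]; exact: mem_conv.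
apply/relint_conv/(wc s) => //; first exact: filter_subseq.
by apply: contra t0 => /eqP E; rewrite -size_eq0 (perm_size tt') E.
Qed.

Lemma circumcenter_edot (t : seq point) (c x y : point) : is_circumcenter t c -> x \in t -> y \in t ->
  2 * edot (x - y) c = edot x x - edot y y.
Proof.
by move=> [_ eqd] xt yt; apply/equidistant_edot; rewrite !eqd.
Qed.

End DualPieces.

(** * The piece of the dual cell given by one chain *)

Section Chain.
Variables (R : realType) (k m : nat).
Local Notation n := (k + m)%N.
Local Notation point := 'rV[R]_n.
Variables (K : seq (seq point)) (s tau p : seq point).
Hypotheses (wc : well_centered K) (sK : s \in K) (fs : bary_free s).
Hypotheses (ss : size s = n.+1) (utau : uniq tau) (stau : size tau = k.+1).
Hypothesis taus : {subset tau <= s}.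
Hypothesis pchain : p \in permutations [seq x <- s | x \notin tau].

Lemma perm_rest : perm_eq p [seq x <- s | x \notin tau].
Proof. by rewrite -mem_permutations. Qed.

Lemma perm_split : perm_eq (tau ++ [seq x <- s | x \notin tau]) s.
Proof.
have us := bary_free_uniq fs.
apply: uniq_perm => //.
  rewrite cat_uniq utau filter_uniq// andbT; apply/hasPn => x.
  by rewrite mem_filter => /andP[].
move=> x; rewrite mem_cat mem_filter; case xt: (x \in tau) => //=.
by rewrite taus.
Qed.

Lemma size_rest : size [seq x <- s | x \notin tau] = m.
Proof.
by have := perm_size perm_split; rewrite size_cat stau ss addSn => -[/addnI].
Qed.

Lemma size_chain : size p = m.
Proof. by rewrite (perm_size perm_rest) size_rest. Qed.

Let c j := circumcenter (tau ++ take j p).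

Lemma chain_center j : is_circumcenter (tau ++ take j p) (c j) /\ Defs.conv s (c j).
Proof.
have pe : perm_eq (tau ++ p) s.
  by rewrite (perm_trans _ perm_split)// perm_cat2l perm_rest.
apply: (wc_circumcenter wc sK fs).
- have : uniq (tau ++ p) by rewrite (perm_uniq pe) bary_free_uniq.
  by rewrite -{1}(cat_take_drop j p) catA cat_uniq => /andP[].
- move=> x; rewrite mem_cat -(perm_mem pe) mem_cat => /orP[->//|/mem_take ->].
  by rewrite orbT.
- by rewrite -size_eq0 size_cat stau.
Qed.

Lemma pieceE : piece tau p = c 0 :: [seq c j | j <- iota 1 m].
Proof. by rewrite /piece size_chain. Qed.

Lemma size_elist_tau : size (elist tau) = k.
Proof. by case: tau stau => // x t [sw]; rewrite size_elist. Qed.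

Lemma size_elist_piece : size (elist (piece tau p)) = m.
Proof. by rewrite pieceE size_elist size_map size_iota. Qed.

Local Notation E := (rowsmx k (elist tau)).
Local Notation F := (rowsmx m (elist (piece tau p))).

Lemma row_E i : exists x y, x \in tau /\ y \in tau /\ row i E = x - y.
Proof.
case: tau stau => // x0 w [sw]; exists (nth 0 w i), x0; rewrite mem_head.
have iw : (i < size w)%N by rewrite sw.
split; first by rewrite inE mem_nth// orbT.
by split=> //; rewrite rowK nth_elist.
Qed.

Lemma row_F i : row i F = c i.+1 - c 0.
Proof.
rewrite rowK pieceE nth_elist; last by rewrite size_map size_iota.
by rewrite (nth_map 0%N) ?size_iota// nth_iota.
Qed.

(** Every center of the chain is equidistant from the vertices of tau, so all of them have the same
    scalar product with an edge of tau. *)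
Lemma chain_orth : E *m F^T = 0.
Proof.
apply/matrixP => i j; rewrite [RHS]mxE.
have -> : (E *m F^T) i j = edot (row i E) (row j F).
  by rewrite mxE; apply: eq_bigr => l _; rewrite !mxE.
have [x [y [xt [yt ->]]]] := row_E i; rewrite row_F.
have ml z q : z \in tau -> z \in tau ++ q by move=> zt; rewrite mem_cat zt.
have h l := circumcenter_edot (chain_center l).1 (ml _ _ xt) (ml _ _ yt).
rewrite edotC edotBl [edot (c j.+1) _]edotC [edot (c 0) _]edotC.
by have := h j.+1; have := h 0%N; lra.
Qed.

Lemma vol_tau : vol tau = Num.sqrt (\det (E *m E^T)) / k`!%:R.
Proof. exact: volE size_elist_tau. Qed.

Lemma vol_piece : vol (piece tau p) = Num.sqrt (\det (F *m F^T)) / m`!%:R.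
Proof. exact: volE size_elist_piece. Qed.

(** By orthogonality |\det (E; F)| is the product of the volumes times k! m!. Well-centeredness puts
    the centers in s, so the rows are differences of points of s. *)
Lemma vol_mul_le : vol tau * vol (piece tau p) <= n`!%:R * `|sdet (elist s)|.
Proof.
have cb : `|\det (col_mx E F)| <= n`!%:R * `|sdet (elist s)|.
  rewrite sdetE; apply: det_rows_bound => i.
  rewrite -[i]splitK /unsplit; case: (fintype.split i) => j.
    rewrite rowKu; have [x [y [xt [yt ->]]]] := row_E j.
    exact: (conv_diff ss (mem_conv (taus xt)) (mem_conv (taus yt))).
  rewrite rowKd row_F; exact: (conv_diff ss (chain_center _).2 (chain_center _).2).
apply: le_trans cb; rewrite -sqrtr_sqr (det_col_mx_orth chain_orth).
rewrite sqrtrM ?gram_det_ge0// vol_tau vol_piece mulrACA -[leRHS]mulr1.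
rewrite ler_wpM2l ?mulr_ge0 ?sqrtr_ge0// -invfM invf_le1 ?mulr_gt0 ?ltr0n ?fact_gt0//.
by rewrite -natrM ler1n muln_gt0 !fact_gt0.
Qed.

Lemma vol_piece_ge0 : 0 <= vol (piece tau p).
Proof. by rewrite vol_piece divr_ge0// sqrtr_ge0. Qed.

Lemma chain_estimate (w : kform R n) (d : R) (N : R := #|{set 'I_n}|%:R) : 0 <= d ->
  0 < vol tau ->
  (forall I : {set 'I_n}, #|I| = k -> forall x y, Defs.conv s x -> Defs.conv s y ->
     `|w I x - w I y| <= d) ->
  `|vol (piece tau p) / vol tau * sint w tau -
    Num.sg (sdet (elist tau ++ elist (piece tau p))) * sint (hodge w) (piece tau p)|
  <= 2 * N * d * vol (piece tau p).
Proof.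
move=> d0 vt wd; have hd (J : {set 'I_n}) : #|J| = m -> forall x y,
    Defs.conv s x -> Defs.conv s y -> `|hodge w J x - hodge w J y| <= d.
  move=> Jm x y cx cy; rewrite /hodge -mulrBr normrM normr_sign mul1r.
  apply: wd => //; apply/eqP; rewrite -card_setC_km finset.setCK; exact/eqP.
have cc0 : Defs.conv s (c 0) by have [] := chain_center 0.
have tau_s y : Defs.conv tau y -> Defs.conv s y.
  by apply: conv_conv => x /taus; exact: mem_conv.
have piece_s y : Defs.conv (piece tau p) y -> Defs.conv s y.
  apply: conv_conv => x /mapP[j _ ->]; by have [] := chain_center j.
set a := formval w (c 0) (elist tau).
set b := formval (hodge w) (c 0) (elist (piece tau p)).
have T1 : `|sint w tau - a / k`!%:R| <= N * d * vol tau.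
  rewrite vol_tau mulrA /a.
  have := size_elist_tau; have : forall y, Defs.conv tau y ->
     `|formval w y (elist tau) - formval w (c 0) (elist tau)| <=
      N * d * Num.sqrt (\det (E *m E^T)).
    move=> y /tau_s cy; apply: formval_lip => //; first exact: size_elist_tau.
    by move=> I Ik; apply: wd.
  case: tau stau => // x0 vs [svs] H _.
  by have := sint_near H; rewrite svs.
have T2 : `|sint (hodge w) (piece tau p) - b / m`!%:R| <= N * d * vol (piece tau p).
  rewrite vol_piece mulrA /b.
  have : forall y, Defs.conv (piece tau p) y ->
     `|formval (hodge w) y (elist (piece tau p)) -
       formval (hodge w) (c 0) (elist (piece tau p))| <=
      N * d * Num.sqrt (\det (F *m F^T)).
    move=> y /piece_s cy; apply: formval_lip => //; first exact: size_elist_piece.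
    by move=> J Jm; apply: hd.
  rewrite pieceE => H; have := sint_near H.
  by rewrite size_map size_iota.
have := hodge_formval w (c 0) size_elist_tau size_elist_piece chain_orth.
rewrite -(rowsmx_cat _ _ size_elist_tau) -sdetE -/a -/b.
set sg := Num.sg _ => id.
have sgle : `|sg| <= 1 by rewrite /sg normr_sg; case: (_ == _); rewrite ?ler01.
have main : vol (piece tau p) / vol tau * (a / k`!%:R) = sg * (b / m`!%:R).
  have fk : k`!%:R != 0 :> R by rewrite pnatr_eq0 -lt0n fact_gt0.
  have fm : m`!%:R != 0 :> R by rewrite pnatr_eq0 -lt0n fact_gt0.
  have GE : Num.sqrt (\det (E *m E^T)) != 0.
    by apply: contraTneq vt; rewrite vol_tau => ->; rewrite mul0r ltxx.
  rewrite vol_piece vol_tau; apply: (mulfI GE).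
  transitivity (sg * Num.sqrt (\det (E *m E^T)) * b / m`!%:R); last by field.
  by rewrite id; field; rewrite fk fm GE.
rewrite (_ : _ - _ = vol (piece tau p) / vol tau * (sint w tau - a / k`!%:R) -
    sg * (sint (hodge w) (piece tau p) - b / m`!%:R)); last first.
  by rewrite !mulrBr main opprB addrA subrK.
have t1 : `|vol (piece tau p) / vol tau * (sint w tau - a / k`!%:R)| <=
    N * d * vol (piece tau p).
  rewrite normrM (ger0_norm (divr_ge0 vol_piece_ge0 (ltW vt))) mulrAC ler_pdivrMr//.
  by rewrite [leRHS]mulrAC [leRHS]mulrC ler_wpM2l ?vol_piece_ge0.
have t2 : `|sg * (sint (hodge w) (piece tau p) - b / m`!%:R)| <= N * d * vol (piece tau p).
  by rewrite normrM; apply: le_trans T2; apply: ler_piMl.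
have -> : 2 * N * d * vol (piece tau p) =
  N * d * vol (piece tau p) + N * d * vol (piece tau p) by ring.
exact: le_trans (ler_normB _ _) (lerD t1 t2).
Qed.

End Chain.

(** * The error estimate *)

Lemma compact_union_hulls (R : realType) (n : nat) (K : seq (seq 'rV[R]_n)) :
  compact (union_hulls K).
Proof.
elim: K => [|s K IH].
  have -> : union_hulls [::] = set0 :> set 'rV[R]_n.
    by rewrite -subset0 => x [].
  exact: compact0.
have -> : union_hulls (s :: K) = Defs.conv s `|` union_hulls K.
  rewrite eqEsubset; split=> x.
    by case=> t; rewrite inE => /predU1P[->|tK] tx; [left|right; exists t].
  by case=> [sx|[t tK tx]]; [exists s; rewrite ?mem_head|exists t; rewrite ?inE ?tK ?orbT].
by apply: compactU IH; exact: compact_conv.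
Qed.

Lemma C1_form_lipschitz (R : realType) (n k : nat) (P : set 'rV[R]_n) (w : kform R n) :
  compact P -> C1_form_on P k w ->
  exists2 L : R, 0 <= L & forall I : {set 'I_n}, #|I| = k ->
    forall x y, P x -> P y -> `|w I x - w I y| <= L * `|x - y|.
Proof.
move=> cP [U [oU [PU wU]]].
have lip (I : {set 'I_n}) : exists L : R, #|I| = k ->
    forall x y, P x -> P y -> `|w I x - w I y| <= L * `|x - y|.
  have [Ik|nIk] := eqVneq #|I| k; last by exists 0 => Ik; rewrite Ik eqxx in nIk.
  have [cw dw] := wU I Ik.
  by have [L HL] := C1_lipschitz_compact oU PU cP cw dw; exists L.
pose l I := sval (cid (lip I)).
have lP (I : {set 'I_n}) : #|I| = k -> forall x y, P x -> P y ->
  `|w I x - w I y| <= l I * `|x - y| := svalP (cid (lip I)).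
exists (\sum_I `|l I|); first by rewrite sumr_ge0.
move=> I Ik x y Px Py; apply: (le_trans (lP I Ik x y Px Py)).
rewrite ler_wpM2r// (le_trans (ler_norm _))// (bigD1 I)//= lerDl sumr_ge0//.
Qed.

Lemma sum_chains (R : realType) (n : nat) (K : seq (seq 'rV[R]_n)) tau
    (f : seq 'rV[R]_n -> R) :
  \sum_(p <- chains K tau) f p =
  \sum_(s <- K | all (fun x => x \in s) tau)
    \sum_(p <- permutations [seq x <- s | x \notin tau]) f p.
Proof. by rewrite /chains big_flatten big_map big_filter. Qed.

(* Summed over the chains through one n-simplex s, vol tau * vol piece is at
   most m! n! det s, and the simplices around tau fit in a box of side 2h. *)
Lemma dual_hodge_error (R : realType) (k m : nat) (n := (k + m)%N)
    (P : set 'rV[R]_n) (K : seq (seq 'rV[R]_n)) (w : kform R n) (L : R)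
    (tau sigma : seq 'rV[R]_n) :
  triangulates K P -> well_centered K -> 0 <= L ->
  (forall I : {set 'I_n}, #|I| = k -> forall x y, P x -> P y ->
     `|w I x - w I y| <= L * `|x - y|) ->
  sigma \in K -> uniq tau -> size tau = k.+1 -> {subset tau <= sigma} ->
  `|disc_hodge_int w K tau - dual_int (hodge w) K tau| <=
    2 * #|{set 'I_n}|%:R * L * (m`!%:R * n`!%:R * (2 * (n.*2.+1)%:R) ^+ n) *
      (k%:R ^+ k * k`!%:R) * mesh K ^+ n.+1 / inrad tau ^+ k.
Proof.
move=> tri wc L0 wL sigK utau stau tausig.
have [Ks _ _ PE] := tri.
have free s : s \in K -> bary_free s.
  by move=> /Ks[[ss _] ds]; apply: size_nsimplex_free; rewrite // gt_eqF.
have taufree := bary_free_sub (free _ sigK) utau tausig.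
have [x0 [vs [tauE svs]]] : exists x0 vs, tau = x0 :: vs /\ size vs = k.
  by case: tau stau {utau tausig taufree} => // x0 vs [<-]; exists x0, vs.
have vtE : vol tau = Num.sqrt (\det (rowsmx k (elist tau) *m (rowsmx k (elist tau))^T)) / k`!%:R.
  by apply: volE; rewrite tauE size_elist.
have tfree : forall u : 'rV_k, u *m rowsmx k (elist tau) = 0 -> u = 0.
  rewrite tauE in taufree *; have := bary_free_row taufree; by rewrite svs.
have kf : 0 < k`!%:R :> R by rewrite ltr0n fact_gt0.
have vt : 0 < vol tau by rewrite vtE divr_gt0// sqrtr_gt0 gram_det_gt0.
have [inr0 inrk] : 0 < inrad tau ^+ k /\ inrad tau ^+ k <= k%:R ^+ k * k`!%:R * vol tau.
  have -> : k%:R ^+ k * k`!%:R * vol tau =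
    k%:R ^+ k * Num.sqrt (\det (rowsmx k (elist tau) *m (rowsmx k (elist tau))^T)).
    by rewrite vtE -mulrA; congr (_ * _); rewrite mulrC divfK ?gt_eqF.
  (* For k = 0 the inradius occurs only through its power 0, which is 1. *)
  have [k0|kp] := posnP k.
    have -> : \det (rowsmx k (elist tau) *m (rowsmx k (elist tau))^T) = 1.
      have det0 q (M : 'M[R]_q) : q = 0%N -> \det M = 1.
        by move=> q0; subst q; rewrite det_mx00.
      exact: det0.
    by rewrite sqrtr1 k0 !expr0 mulr1 ltr01 lexx.
  have gen q (G := rowsmx q (elist (x0 :: vs))) : q = size vs ->
      (forall u : 'rV_q, u *m G = 0 -> u = 0) -> (0 < q)%N ->
      0 < inrad (x0 :: vs) /\
      inrad (x0 :: vs) ^+ q <= q%:R ^+ q * Num.sqrt (\det (G *m G^T)).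
    by move=> e; subst q; exact: inrad_gt0.
  rewrite tauE in tfree *.
  have [i0 ik] := gen _ (esym svs) tfree kp.
  by rewrite exprn_gt0.
set h := mesh K; have h0 : 0 <= h := mesh_ge0 K.
set N : R := #|{set 'I_n}|%:R.
have convP s y : s \in K -> Defs.conv s y -> P y by move=> sK sy; rewrite PE; exists s.
have lipK s : s \in K -> forall I : {set 'I_n}, #|I| = k -> forall x y,
    Defs.conv s x -> Defs.conv s y -> `|w I x - w I y| <= L * h.
  move=> sK I Ik x y cx cy; apply: (le_trans (wL I Ik _ _ (convP _ _ sK cx) (convP _ _ sK cy))).
  rewrite ler_wpM2l//; apply/mxnormP => // i; exact: (coord_diff_mesh _ sK).
have diffE : disc_hodge_int w K tau - dual_int (hodge w) K tau =
   \sum_(p <- chains K tau) (vol (piece tau p) / vol tau * sint w tau -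
    Num.sg (sdet (elist tau ++ elist (piece tau p))) * sint (hodge w) (piece tau p)).
  by rewrite sumrB /disc_hodge_int /dual_vol !mulr_suml.
have dvol : \sum_(p <- chains K tau) vol (piece tau p) <=
    m`!%:R * n`!%:R * (2 * (n.*2.+1)%:R * h) ^+ n / vol tau.
  rewrite sum_chains ler_pdivlMr// mulr_suml.
  apply: (@le_trans _ _ (\sum_(s <- K | all (fun x => x \in s) tau)
      m`!%:R * n`!%:R * sdet (elist s))); last first.
    rewrite -mulr_sumr ler_wpM2l ?mulr_ge0//.
    by apply: star_det_sum tri _; rewrite -size_eq0 stau.
  rewrite big_seq_cond [leRHS]big_seq_cond.
  apply: ler_sum => s /andP[sK /allP ts].
  have [[ss _] ds] := Ks _ sK.
  have sr := size_rest (free _ sK) ss utau stau ts.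
  rewrite mulr_suml big_seq.
  apply: (@le_trans _ _ (\sum_(p <- permutations [seq x <- s | x \notin tau])
     n`!%:R * sdet (elist s))).
    rewrite [leRHS]big_seq; apply: ler_sum => p pp.
    have := vol_mul_le wc sK (free _ sK) ss utau stau ts pp.
    by rewrite mulrC (gtr0_norm ds).
  (* The number of chains from tau up to s. *)
  have -> : m`! = size (permutations [seq x <- s | x \notin tau]).
    by rewrite size_permutations ?sr// filter_uniq// (bary_free_uniq (free _ sK)).
  by rewrite big_const_seq count_predT iter_addr_0 -[leLHS]mulr_natl mulrA.
rewrite diffE; apply: (le_trans (ler_norm_sum _ _ _)).
apply: (@le_trans _ _ (2 * N * (L * h) * \sum_(p <- chains K tau) vol (piece tau p))).
  rewrite !sum_chains mulr_sumr big_seq_cond [leRHS]big_seq_cond.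
  apply: ler_sum => s /andP[sK /allP ts].
  have [[ss _] ds] := Ks _ sK.
  rewrite mulr_sumr big_seq [leRHS]big_seq; apply: ler_sum => p pp.
  apply: (chain_estimate wc sK (free _ sK) ss utau stau ts pp) => //.
    by rewrite mulr_ge0.
  exact: lipK.
apply: (@le_trans _ _ (2 * N * (L * h) * (m`!%:R * n`!%:R * (2 * (n.*2.+1)%:R * h) ^+ n / vol tau))).
  by rewrite ler_wpM2l ?mulr_ge0.
(* The only use of the inradius: it replaces the last factor 1 / |tau|. *)
have inv_le : (vol tau)^-1 <= k%:R ^+ k * k`!%:R / inrad tau ^+ k.
  by rewrite ler_pdivlMr// mulrC ler_pdivrMr.
set A := m`!%:R * n`!%:R; set B := 2 * (n.*2.+1)%:R.
set X := k%:R ^+ k * k`!%:R in inv_le *.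
have -> : 2 * N * (L * h) * (A * (B * h) ^+ n / vol tau) =
  2 * N * L * (A * B ^+ n) * h ^+ n.+1 * (vol tau)^-1.
  by rewrite exprMn exprS; ring.
have -> : 2 * N * L * (A * B ^+ n) * X * h ^+ n.+1 / inrad tau ^+ k =
  2 * N * L * (A * B ^+ n) * h ^+ n.+1 * (X / inrad tau ^+ k) by ring.
by rewrite ler_wpM2l// !mulr_ge0// exprn_ge0// mulr_ge0.
Qed.

Theorem theorem3p2 (R : realType) (n k : nat) (P : set 'rV[R]_n)
  (Idx : Type) (K : Idx -> seq (seq 'rV[R]_n)) (omega : kform R n) :
  is_polytope P ->
  (forall h, triangulates (K h) P) ->
  (forall h, well_centered (K h)) ->
  C1_form_on P k omega ->
  exists C : R, forall (h : Idx) (sigma : seq 'rV[R]_n), sigma \in K h ->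
    forall f : 'I_k.+1 -> 'I_n.+1, injective f ->
    let tau := [seq nth 0 sigma (f j) | j <- enum 'I_k.+1] in
    `| disc_hodge_int omega (K h) tau - dual_int (hodge omega) (K h) tau |
      <= C * mesh (K h) ^+ n.+1 / inrad tau ^+ k.
Proof.
move=> [Ks [_ PE]] tri wc C1.
have cP : compact P by rewrite PE; exact: compact_union_hulls.
have [L L0 wL] := C1_form_lipschitz cP C1.
have [kn|nk] := leqP k n; last first.
  (* For k > n there is no injective f, hence no face. *)
  exists 0 => h s _ f /leq_card; rewrite !card_ord => kn.
  by rewrite ltnS leqNgt nk in kn.
have [m nE] : exists m, n = (k + m)%N by exists (n - k)%N; rewrite subnKC.
(* Origin of the factors: freezing, chains per n-simplex (m!), [det_rows_bound] (n!), packing, and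
   inradius against volume (k^k k!). *)
subst n; exists (2 * #|{set 'I_(k + m)}|%:R * L *
  (m`!%:R * (k + m)`!%:R * (2 * ((k + m).*2.+1)%:R) ^+ (k + m)) *
  (k%:R ^+ k * k`!%:R)) => h s sK f fI /=.
have [/(_ _ sK)[[ss _] ds] _ _ _] := tri h.
have us : uniq s by apply/bary_free_uniq/size_nsimplex_free; rewrite // gt_eqF.
apply: (dual_hodge_error (tri h) (wc h) L0 wL sK).
- rewrite map_inj_uniq ?enum_uniq// => i j /eqP.
  by rewrite nth_uniq ?ss// => /eqP/val_inj/fI.
- by rewrite size_map size_enum_ord.
- by move=> x /mapP[j _ ->]; rewrite mem_nth// ss.
Qed.
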